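(* For a lattice polygon $P\subset\mathbb{R}^2$ let $\mathrm{G}(\mathrm{bd}\,P)$ and $\mathrm{G}(\mathrm{int}\,P)$ denote the numbers of lattice points in the boundary and in the interior of $P$, respectively. Then: (i) For every lattice polygon $P$, every non-real zero of the Ehrhart polynomial $\mathrm{G}(s,P)$ lies on the circle $$\left\{s\in\mathbb{C}:\left|s+\frac{2}{\mathrm{G}(\mathrm{bd}\,P)}\right|=\frac{2}{\mathrm{G}(\mathrm{bd}\,P)}\right\}.$$ (ii) For a lattice polygon $P$, the zeros of $\mathrm{G}(s,P)$ are real if and only if $$\left(\frac{\mathrm{G}(\mathrm{bd}\,P)}{4}-1\right)^2\ge\mathrm{G}(\mathrm{int}\,P).$$ (iii) $$\Gamma(2)\subset\left\{-2,-1,-\tfrac23\right\}\cup\left\{s=a+\mathrm{i}\,b\in\mathbb{C}\ (a,b\in\mathbb{R}):-\tfrac12\le a<0,\ \left|s+\tfrac23\right|\le\tfrac23\right\}.$$ (iv) The set of cluster points of $\Gamma(2)$ in $\mathbb{C}$ is exactly the real interval $[-1/2,0]$. (v) $\Gamma(2,0)=\{-1\}\cup\{-2/l:l\in\mathbb{Z},\,l\ge1\}$. (vi) The set of elements of $\Gamma(2)$ with real part $-1/2$ is exactly the set of zeros of Ehrhart polynomials of lattice polygons $P$ with $\mathrm{G}(\mathrm{int}\,P)=1$ and $\mathrm{G}(\mathrm{bd}\,P)\le8$. Up to unimodular equivalence there is exactly one remaining lattice polygon $P$ with $\mathrm{G}(\mathrm{int}\,P)=1$ (i.e. with $\mathrm{G}(\mathrm{bd}\,P)>8$);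 it has $\mathrm{G}(\mathrm{bd}\,P)=9$, and the zeros of its Ehrhart polynomial are $-2/3$ and $-1/3$.
   Context: A lattice polygon is a two-dimensional convex polytope $P\subset\mathbb{R}^2$ all of whose vertices lie in $\mathbb{Z}^2$. Its Ehrhart polynomial is the unique polynomial $\mathrm{G}(s,P)$ in $s\in\mathbb{C}$ (of degree $2$) with $\mathrm{G}(k,P)=\#(kP\cap\mathbb{Z}^2)$ for all positive integers $k$. $\Gamma(2)\subset\mathbb{C}$ is the set of all zeros of Ehrhart polynomials of lattice polygons, and $\Gamma(2,0)$ is the set of zeros of Ehrhart polynomials of lattice polygons having no interior lattice points. A cluster point of a set $A\subset\mathbb{C}$ is a point every neighbourhood of which contains infinitely many elements of $A$. Two lattice polygons are unimodularly equivalent if one is the image of the other under a map $x\mapsto Ux+t$ with $U\in GL_2(\mathbb{Z})$, $t\in\mathbb{Z}^2$. *)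

(* Defs.v *)
From HB Require Import structures.
From mathcomp Require Import all_boot all_order all_algebra.
From mathcomp Require Import finmap.
From mathcomp Require Import all_classical all_reals all_analysis.
From mathcomp Require Import complex.

Set Implicit Arguments.
Unset Strict Implicit.
Unset Printing Implicit Defensive.

Import Order.TTheory GRing.Theory Num.Theory.
Import numFieldNormedType.Exports.

Local Open Scope classical_set_scope.
Local Open Scope ring_scope.

Section LatticePolygons.
Variable R : realType.

Implicit Types (A P Q : set 'cV[R]_2).

Definition lattice : set 'cV[R]_2 := [set x | forall i, x i 0 \is a Num.int].

Definition convex_hull A : set 'cV[R]_2 :=
  [set x | exists n (v : 'I_n -> 'cV[R]_2) (w : 'I_n -> R),
    [/\ forall i, A (v i), forall i, 0 <= w i,
        \sum_i w i = 1 & x = \sum_i w i *: v i]].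

Definition affine_hull A : set 'cV[R]_2 :=
  [set x | exists n (v : 'I_n -> 'cV[R]_2) (w : 'I_n -> R),
    [/\ forall i, A (v i), \sum_i w i = 1 & x = \sum_i w i *: v i]].

Definition convex_polytope P := exists2 V, finite_set V & P = convex_hull V.

(* The only 2-dimensional affine subspace of the plane is the plane itself. *)
Definition two_dimensional P := affine_hull P = setT.

(* The vertices of a polytope are its extreme points. *)
Definition vertices P : set 'cV[R]_2 :=
  [set x | P x /\ forall y z (t : R), P y -> P z -> 0 < t < 1 ->
    x = t *: y + (1 - t) *: z -> y = z].

Definition lattice_polygon P :=
  [/\ convex_polytope P, two_dimensional P & vertices P `<=` lattice].

(* [fset_set] sends infinite sets to the empty set; this is only applied to
   bounded sets, which contain finitely many lattice points. *)
Definition card_lattice A : nat := #|` fset_set (A `&` lattice)|.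

Definition card_bd P : nat := card_lattice (closure P `\` interior P).

Definition card_int P : nat := card_lattice (interior P).

Definition dilate (k : nat) P : set 'cV[R]_2 := [set k%:R *: x | x in P].

Definition is_ehrhart P (p : {poly R[i]}) :=
  forall k, (0 < k)%N -> p.[k%:R] = (card_lattice (dilate k P))%:R.

(* A polynomial satisfying [is_ehrhart P] is unique, as its values at infinitely
   many points are prescribed; [xget] defaults to 0 if there were none. *)
Definition ehrhart P : {poly R[i]} := xget 0 [set p | is_ehrhart P p].

Definition ehrhart_zeros P : set R[i] := [set s | root (ehrhart P) s].

Definition Gamma2 : set R[i] :=
  [set s | exists2 P, lattice_polygon P & ehrhart_zeros P s].

Definition Gamma20 : set R[i] :=
  [set s | exists P,
    [/\ lattice_polygon P, card_int P = 0%N & ehrhart_zeros P s]].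

Definition cluster_points (A : set R[i]) : set R[i] :=
  [set z | forall U, nbhs (z : R[i]^o) U -> infinite_set (U `&` A)].

Definition unimodularly_equivalent P Q :=
  exists (U : 'M[int]_2) (t : 'cV[int]_2), U \in unitmx /\
    Q = [set map_mx intr U *m x + map_mx intr t | x in P].

End LatticePolygons.

Arguments Gamma2 R : clear implicits.
Arguments Gamma20 R : clear implicits.

(* Main.v *)
(* Over the integer abscissas the upper and the lower boundary of a lattice polygon P are
   graphs that are linear between lattice points, and the floors of a linear function
   between two lattice points have an explicit sum.  Summing the numbers of lattice points
   of kP over the vertical lines yields Pick's theorem and Ehrhart's theorem: twice the
   Ehrhart polynomial is (2 i + b - 2) s^2 + b s + 2, where i and b are the numbers of
   interior and of boundary lattice points.  Its discriminant is (b - 4)^2 - 16 i, whence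
   (i) and (ii).

   The bounds on the real zeros amount to Scott's inequality b <= 2 i + 6 for i > 0, the only
   exception being b = 9, i = 1.  Scott's argument: let W be the width of P in the direction
   of x and Q the total length of its two vertical sides, so that b <= Q + 2 W and twice the
   area is at least W Q.  This suffices unless W >= 3 and Q <= 3.  If W = 3 then b <= 9, with
   equality for i = 1 only if all boundary slopes are integral, and P is equivalent to the
   triangle x, y >= 0, x + y <= 3.  If W >= 4, a shear brings the two vertical sides so close
   that P contains a quadrilateral of large enough area, unless P is narrower in the
   direction of y than in that of x, and then one exchanges the coordinates.

   Quadrilaterals with i = w - 1 and b = n + 4, for all n <= 2 w, have zeros that are dense
   in [-1/2, 0]; conversely, zeros with imaginary part bounded away from 0 have bounded
   i and b. *)

Require Import Defs.
From HB Require Import structures.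
From mathcomp Require Import all_boot all_order all_algebra.
From mathcomp Require Import finmap.
From mathcomp Require Import all_classical all_reals all_analysis.
From mathcomp Require Import complex.
From mathcomp Require Import zify ring lra.

Set Implicit Arguments.
Unset Strict Implicit.
Unset Printing Implicit Defensive.

Import Order.TTheory GRing.Theory Num.Theory.
Import numFieldNormedType.Exports.

Local Open Scope classical_set_scope.
Local Open Scope ring_scope.

(** * Sums of integer quotients and upper hulls *)

(** The floor of [- x] is minus the ceiling of [x], and the ceiling exceeds the floor by 1 unless
    [x] is an integer. *)
Lemma divzN (m : int) (w : nat) : (0 < w)%N ->
  ((- m) %/ w)%Z = - (m %/ w)%Z - 1 + (w %| m)%Z%:Z.
Proof.
move=> w0; have w0' : (w : int) != 0 by lia.
have Em := divz_eq m w; have r0 := modz_ge0 m w0'.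
have rw := ltz_pmod m (d := w); rewrite ltz_nat in rw; move/(_ w0) in rw.
case: (boolP (w %| m)%Z) => dv.
  have r1 : (m %% w)%Z = 0 by apply/dvdz_mod0P.
  by rewrite {1}Em r1 addr0 -mulNr mulzK //=; lia.
have r1 : (m %% w)%Z != 0 by apply: contraNN dv => /eqP/dvdz_mod0P.
rewrite {1}Em /= addr0.
have -> : - ((m %/ w)%Z * w + (m %% w)%Z) = (- (m %/ w)%Z - 1) * w + (w%:Z - (m %% w)%Z).
  by ring.
rewrite divzMDl // (@divz_small (w%:Z - _)) ?addr0 //; lia.
Qed.

Lemma sum_divz (w : nat) (h : int) : (0 < w)%N ->
  (\sum_(i < w) (h * i%:Z %/ w)%Z) *+ 2
  = w%:Z * h - w%:Z - h + \sum_(i < w) (w %| h * i%:Z)%Z%:Z.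
Proof.
case: w => // w _.
(* Pair i with w - i: the two quotients add up to h - 1, or to h if w divides h * i. *)
rewrite !big_ord_recl /= !mulr0 div0z dvdz0 add0r.
rewrite mulr2n {2}(reindex_inj rev_ord_inj) /= -big_split /=.
have -> : \sum_(i < w) ((h * (bump 0 i)%:Z %/ w.+1)%Z
            + (h * (bump 0 (w - i.+1))%:Z %/ w.+1)%Z) =
          \sum_(i < w) ((h - 1) + (w.+1 %| h * (bump 0 i)%:Z)%Z%:Z).
  apply: eq_bigr => i _; rewrite /bump !add1n.
  have -> : h * ((w - i.+1).+1)%:Z = h * w.+1 + - (h * i.+1%:Z).
    have -> : ((w - i.+1).+1)%:Z = w.+1%:Z - i.+1%:Z by have := ltn_ord i; lia.
    by ring.
  by rewrite divzMDl // divzN //; ring.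
rewrite big_split /= sumr_const card_ord -mulr_natl.
have -> : w.+1%:Z = w%:Z + 1 by lia.
by rewrite natz; ring.
Qed.

Lemma sum_periodic (f : nat -> int) (w k : nat) :
  (forall i, f (w + i)%N = f i) ->
  \sum_(i < k * w) f i = k%:Z * \sum_(i < w) f i.
Proof.
move=> fP; elim: k => [|k IH]; first by rewrite mul0n big_ord0 mul0r.
rewrite mulSn big_split_ord /=.
under [X in _ + X]eq_bigr => i _ do rewrite fP.
by rewrite IH -addn1 PoszD; ring.
Qed.

Lemma argmax_seq (T : eqType) (f : T -> int) (s : seq T) : s != [::] ->
  exists2 r, r \in s & forall x, x \in s -> f x <= f r.
Proof.
elim: s => // a s IH _; case: (eqVneq s [::]) => [->|/IH [r rs rP]].
  by exists a => [|x]; rewrite inE // => /eqP->.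
have [ar|ra] := lerP (f a) (f r).
  by exists r => [|x]; rewrite inE ?rs ?orbT // => /orP[/eqP->//|/rP].
exists a => [|x]; rewrite inE ?eqxx // => /orP[/eqP->//|/rP xr].
exact: le_trans xr (ltW ra).
Qed.

Section Hull.
Variable R : realType.
Implicit Types (K : R -> R -> Prop) (S : seq (int * int)).

Definition top K x y := K x y /\ forall z, K x z -> z <= y.

(* K is a two-dimensional convex set with K = conv S; the inclusion of K in conv S is
   expressed by half-planes. *)
Record gen_convex K S : Prop := GenConvex {
  gc_convex : forall x y x' y' t, K x y -> K x' y' -> 0 <= t <= 1 ->
    K (t * x + (1 - t) * x') (t * y + (1 - t) * y');
  gc_gen : forall s, s \in S -> K s.1%:~R s.2%:~R;
  gc_ineq : forall a b c : R,
    (forall s, s \in S -> a * s.1%:~R + b * s.2%:~R <= c) ->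
    forall x y, K x y -> a * x + b * y <= c;
  gc_plane : forall a b c : R,
    (forall x y, K x y -> a * x + b * y = c) -> a = 0 /\ b = 0 }.

Definition topz K (p : int * int) := top K p.1%:~R p.2%:~R.

Lemma top_uniq K x y z : top K x y -> top K x z -> y = z.
Proof. by move=> [Ky yP] [Kz zP]; apply/eqP; rewrite eq_le zP // yP. Qed.

Section Gen.
Variables (K : R -> R -> Prop) (S : seq (int * int)).
Hypothesis gK : gen_convex K S.

Lemma convex_chord x1 y1 x2 y2 x : K x1 y1 -> K x2 y2 -> x1 < x2 ->
  x1 <= x <= x2 -> K x (y1 + (y2 - y1) * (x - x1) / (x2 - x1)).
Proof.
move=> K1 K2 x12 /andP[xa xb].
have d0 : 0 < x2 - x1 by lra.
have := gc_convex gK (t := (x - x1) / (x2 - x1)) K2 K1.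
have -> : (x - x1) / (x2 - x1) * x2 + (1 - (x - x1) / (x2 - x1)) * x1 = x.
  by field; apply/lt0r_neq0.
have -> : (x - x1) / (x2 - x1) * y2 + (1 - (x - x1) / (x2 - x1)) * y1
  = y1 + (y2 - y1) * (x - x1) / (x2 - x1) by field; apply/lt0r_neq0.
apply; rewrite divr_ge0 /= ?ler_pdivrMr; lra.
Qed.

(** Stated without division, so that at lattice points it turns into an inequality between
    integers. *)
Lemma top_chord x1 y1 x2 y2 x y : K x1 y1 -> K x2 y2 -> x1 < x2 ->
  x1 <= x <= x2 -> top K x y ->
  (y2 - y1) * (x - x1) <= (y - y1) * (x2 - x1).
Proof.
move=> K1 K2 x12 xin [_ yP]; have := yP _ (convex_chord K1 K2 x12 xin).
by rewrite -lerBrDl ler_pdivrMr ?subr_gt0.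
Qed.

(** Brings a bound on the height above a chord into the shape that [gc_ineq] accepts. *)
Lemma below_line (p1 p2 q1 q2 x y c : R) :
  ((y - p2) * (q1 - p1) - (q2 - p2) * (x - p1) <= c) =
  ((p2 - q2) * x + (q1 - p1) * y <= c + p2 * (q1 - p1) + (p2 - q2) * p1).
Proof. by rewrite -subr_ge0 -[RHS]subr_ge0; congr (0 <= _); ring. Qed.

(* A generator r highest above the chord pq is again on the upper boundary, strictly
   between p and q; the recursion stops as the abscissas are integers. *)
Lemma hull_ind (Q : int * int -> int * int -> Prop) :
  (forall p q, topz K p -> topz K q -> p.1 < q.1 ->
     (forall x y, K x y -> (y - p.2%:~R) * (q.1%:~R - p.1%:~R)
                 <= (q.2%:~R - p.2%:~R) * (x - p.1%:~R)) -> Q p q) ->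
  (forall p r q, topz K p -> topz K r -> topz K q -> p.1 < r.1 -> r.1 < q.1 ->
     Q p r -> Q r q -> Q p q) ->
  forall p q, topz K p -> topz K q -> p.1 < q.1 -> Q p q.
Proof.
move=> Qb Qs p q.
have [n] := ubnP `|q.1 - p.1|%N; elim: n p q => // n IH p q nP tp tq pq.
(* Twice the signed area of the triangle [p], [q], [s]; it is positive exactly when [s] lies above
   the chord. *)
pose f (s : int * int) := (s.2 - p.2) * (q.1 - p.1) - (q.2 - p.2) * (s.1 - p.1).
have fE (s : int * int) : (f s)%:~R = (s.2%:~R - p.2%:~R) * (q.1%:~R - p.1%:~R)
    - (q.2%:~R - p.2%:~R) * (s.1%:~R - p.1%:~R) :> R by rewrite /f; ring.
have pqR : (p.1%:~R < q.1%:~R :> R) by rewrite ltr_int.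
have [S0|S0] := eqVneq S [::].
  have := gc_ineq gK (a := 0) (b := 0) (c := -1); rewrite S0 => /(_ _ _ _ tp.1).
  by rewrite !mul0r add0r => H; exfalso; have : (0 : R) <= -1 by [exact: H]; lra.
have [r rS rP] : exists2 r : int * int, r \in S & forall s, s \in S -> f s <= f r.
  exact: argmax_seq.
have Kmax x y : K x y -> (y - p.2%:~R) * (q.1%:~R - p.1%:~R)
    - (q.2%:~R - p.2%:~R) * (x - p.1%:~R) <= (f r)%:~R.
  move=> Kxy.
  rewrite below_line; apply: (gc_ineq gK) Kxy => s /rP.
  by rewrite -(ler_int R) fE below_line.
have [fr0|fr0] := lerP (f r) 0.
  apply: Qb => // x y /Kmax Kxy; rewrite -subr_le0; apply: le_trans Kxy _.
  by rewrite (ler_int _ _ 0).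
have fr0' : (0 : R) < (f r)%:~R by rewrite (ltr_int _ 0).
have Kr := gc_gen gK rS.
(* If [r] were not to the right of [p], then [p] would lie below the chord from [r] to [q], although
   it is highest in its column. *)
have p1r : p.1 < r.1.
  rewrite ltNge; apply/negP => rp; have rpR : (r.1%:~R <= p.1%:~R :> R) by rewrite ler_int.
  have rq : r.1%:~R < q.1%:~R :> R by lra.
  have := top_chord Kr tq.1 rq _ tp; rewrite rpR ltW // => /(_ isT).
  rewrite leNgt => /negP; apply; rewrite -subr_gt0.
  by move: fr0'; rewrite fE; congr (0 < _); ring.
have rq : r.1 < q.1.
  rewrite ltNge; apply/negP => qr; have qrR : (q.1%:~R <= r.1%:~R :> R) by rewrite ler_int.
  have pr : p.1%:~R < r.1%:~R :> R by lra.
  have := top_chord tp.1 Kr pr _ tq; rewrite qrR ltW // => /(_ isT).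
  rewrite leNgt => /negP; apply; rewrite -subr_gt0.
  by move: fr0'; rewrite fE; congr (0 < _); ring.
have tr : topz K r.
  split=> // z /Kmax; rewrite fE => H.
  rewrite -subr_ge0 -(pmulr_lge0 _ (x := q.1%:~R - p.1%:~R)) ?subr_gt0 //.
  by move: H; rewrite -subr_ge0; congr (0 <= _); ring.
apply: (Qs p r q) => //; apply: IH => //; lia.
Qed.

End Gen.
End Hull.

(** * Floor sums along the upper boundary *)

Section FloorSums.
Variable R : realType.
Implicit Types (K : R -> R -> Prop) (S : seq (int * int)).

Definition upper K x : R := xget 0 [set y | top K x y].

Lemma upperE K x y : top K x y -> upper K x = y.
Proof. by move=> t; apply: (@top_uniq _ K x) => //; apply: xgetI t. Qed.

(** Each term is the height of the topmost lattice point in a column of the dilate by [k]. The last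
    column is left out, so that adjacent ranges add up. *)
Definition floorsum K (k : nat) (a : int) (W : nat) : int :=
  \sum_(i < k * W) Num.floor (k%:R * upper K ((k%:Z * a + i%:Z)%:~R / k%:R)).

(* The number of lattice points on the upper boundary over [a, a + W). *)
Definition intcols K (a : int) (W : nat) : nat :=
  \sum_(i < W) (upper K (a + i%:Z)%:~R \is a Num.int).

Lemma floorsumD K k a W1 W2 : floorsum K k a (W1 + W2) =
  floorsum K k a W1 + floorsum K k (a + W1%:Z) W2.
Proof.
rewrite /floorsum mulnDr big_split_ord /=; congr (_ + _).
apply: eq_bigr => i _; congr (Num.floor (_ * upper K (_ / _))).
by congr (_%:~R); rewrite PoszD PoszM; ring.
Qed.

Lemma intcolsD K a W1 W2 :
  intcols K a (W1 + W2) = (intcols K a W1 + intcols K (a + W1%:Z) W2)%N.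
Proof.
rewrite /intcols big_split_ord /=; congr (_ + _)%N.
by apply: eq_bigr => i _; rewrite PoszD addrA.
Qed.

Lemma floor_ratio (m : int) (w : nat) : (0 < w)%N ->
  Num.floor (m%:~R / w%:R : R) = (m %/ w)%Z.
Proof.
move=> w0; have w0R : 0 < w%:R :> R by rewrite ltr0n.
have w0' : (w : int) != 0 by lia.
apply: floor_def; rewrite ler_pdivlMr // ltr_pdivrMr // -[w%:R]/((w%:Z)%:~R) -!intrM.
rewrite ler_int ltr_int {2 3}(divz_eq m w) lerDl modz_ge0 //=.
by rewrite mulrDl mul1r ltrD2l ltz_pmod.
Qed.

Lemma int_ratio (m : int) (w : nat) : (0 < w)%N ->
  (m%:~R / w%:R : R) \is a Num.int = (w %| m)%Z.
Proof.
move=> w0; have w0R : w%:R != 0 :> R by rewrite pnatr_eq0 -lt0n.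
rewrite intrEfloor floor_ratio // -(inj_eq (mulIf w0R)) mulfVK //.
by rewrite -[w%:R]/((w%:Z)%:~R) -intrM eqr_int dvdz_eq.
Qed.

Variables (K : R -> R -> Prop) (S : seq (int * int)).
Hypothesis gK : gen_convex K S.

Lemma top_segment (p q : int * int) x : topz K p -> topz K q -> p.1 < q.1 ->
  (forall x y, K x y -> (y - p.2%:~R) * (q.1%:~R - p.1%:~R)
              <= (q.2%:~R - p.2%:~R) * (x - p.1%:~R)) ->
  p.1%:~R <= x <= q.1%:~R ->
  top K x (p.2%:~R + (q.2%:~R - p.2%:~R) * (x - p.1%:~R) / (q.1%:~R - p.1%:~R)).
Proof.
move=> tp tq pq below xin; rewrite -(ltr_int R) in pq.
split=> [|z /below]; first exact: (convex_chord gK tp.1 tq.1 pq xin).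
by rewrite -lerBlDl ler_pdivlMr ?subr_gt0.
Qed.

(** The line through a linear piece of the upper boundary supports [K]; [h] is its slope. In
    particular every column between the ends has a highest point. *)
Lemma top_supp (p q : int * int) : topz K p -> topz K q -> p.1 < q.1 ->
  forall x : R, p.1%:~R <= x <= q.1%:~R ->
  exists y h, top K x y /\ forall x' y', K x' y' -> y' <= y + h * (x' - x).
Proof.
move: p q; refine (hull_ind gK _ _) => [p q tp tq pq below|p r q tp tr tq _ _ H1 H2] x xin.
  set h : R := (q.2%:~R - p.2%:~R) / (q.1%:~R - p.1%:~R).
  exists (p.2%:~R + (q.2%:~R - p.2%:~R) * (x - p.1%:~R) / (q.1%:~R - p.1%:~R)), h.
  split; first exact: top_segment.
  move=> x' y' /below; rewrite -ler_pdivlMr ?subr_gt0 ?ltr_int // mulrAC -/h => H.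
  by rewrite mulrAC -/h; lra.
by have [xr|rx] := lerP x r.1%:~R; [apply: H1|apply: H2];
  case/andP: xin => ? ?; apply/andP; split => //; apply: ltW.
Qed.

(* al is twice the signed area under the upper boundary. *)
Lemma floorsum_hull (p q : int * int) : topz K p -> topz K q -> p.1 < q.1 ->
  exists al : int,
  (forall k, (0 < k)%N -> floorsum K k p.1 `|q.1 - p.1|%N *+ 2 =
     k%:Z ^+ 2 * al + k%:Z * (p.2 - q.2) - k%:Z * (q.1 - p.1)
     + k%:Z * (intcols K p.1 `|q.1 - p.1|%N)%:Z) /\
  (forall t : int * int, K t.1%:~R t.2%:~R -> p.1 <= t.1 <= q.1 ->
     (t.1 - p.1) * (p.2 + t.2) + (q.1 - t.1) * (t.2 + q.2) <= al).
Proof.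
move: p q; refine (hull_ind gK _ _) => [p q tp tq pq below|p r q tp tr tq pr rq].
  set W := `|q.1 - p.1|%N; set h := q.2 - p.2.
  have WE : q.1 - p.1 = W%:Z by rewrite /W; lia.
  have W0 : (0 < W)%N by lia.
  have W0R : W%:R != 0 :> R by rewrite pnatr_eq0 -lt0n.
  exists ((q.1 - p.1) * (p.2 + q.2)); split; last first.
    move=> t /below; rewrite -!intrB -!intrM ler_int => H tin; lia.
  have up k i : (0 < k)%N -> (i < k * W)%N ->
    k%:R * upper K ((k%:Z * p.1 + i%:Z)%:~R / k%:R) =
    (k%:Z * p.2)%:~R + (h * i%:Z)%:~R / W%:R.
    move=> k0 ikW; have k0R : 0 < k%:R :> R by rewrite ltr0n.
    rewrite (upperE (top_segment tp tq pq below _)).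
      rewrite -(intrB _ q.1) WE -(intrB _ q.2) -/h !(intrD, intrM) /=.
      by field; rewrite W0R lt0r_neq0.
    rewrite ler_pdivlMr // ler_pdivrMr // -[k%:R]/((k%:Z)%:~R) -!intrM !ler_int.
    by apply/andP; split; lia.
  have -> : (intcols K p.1 W)%:Z = \sum_(i < W) (W %| h * i%:Z)%Z%:Z.
    rewrite /intcols -natz natr_sum; apply: eq_bigr => i _; rewrite natz.
    have /= := up 1%N i isT; rewrite mul1n => /(_ (ltn_ord i)).
    rewrite !mul1r divr1 => ->.
    by rewrite rpredDl ?intr_int // int_ratio.
  move=> k k0; rewrite /floorsum.
  (* Extending the fraction by [k] makes [k * W] both the denominator and the number of terms, as in
     [sum_divz]; the divisibility terms that arise depend only on [i] modulo [W]. *)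
  under eq_bigr => i _.
    rewrite (up k i k0 (ltn_ord i)) floorDzr ?intr_int // intrKfloor floor_ratio //.
    rewrite -(@divzMpl k%:Z) ?ltz_nat // mulrA.
    over.
  rewrite big_split /= sumr_const card_ord mulrnDl.
  rewrite (eq_bigr (fun i : 'I_(k * W) => (k%:Z * h * i%:Z %/ (k * W)%N)%Z)); last first.
    by move=> i _; rewrite PoszM.
  rewrite sum_divz ?muln_gt0 ?k0 //.
  rewrite (eq_bigr (fun i : 'I_(k * W) => (W %| h * i%:Z)%Z%:Z)); last first.
    by move=> i _; rewrite PoszM -mulrA dvdz_mul2l //; lia.
  rewrite (@sum_periodic (fun i : nat => (W %| h * i%:Z)%Z%:Z)); last first.
    by move=> i; rewrite PoszD mulrDr rpredDl // dvdz_mull.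
  rewrite -mulrnA -mulr_natl natz PoszM PoszM -WE /h; ring.
move=> [al1 [E1 B1]] [al2 [E2 B2]]; exists (al1 + al2).
have WE : (`|q.1 - p.1| = `|r.1 - p.1| + `|q.1 - r.1|)%N by lia.
have rE : p.1 + `|r.1 - p.1|%N%:Z = r.1 by lia.
split.
  move=> k k0; rewrite WE floorsumD intcolsD rE mulrnDl E1 // E2 // PoszD; ring.
(* For [t] to the left of [r], [al1 + al2] is at least the doubled area under the path [p], [t],
   [r], [q]; dropping [r], which is above the chord from [t] to [q], does not increase the area. The
   other case is symmetric. *)
move=> t Kt /andP[pt tq']; have [tr'|rt] := lerP t.1 r.1.
  have := B1 t Kt; rewrite pt tr' => /(_ isT) H1.
  have := B2 q tq.1; rewrite (ltW rq) lexx => /(_ isT) H2.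
  have trR : (t.1%:~R <= r.1%:~R :> R) && (r.1%:~R <= q.1%:~R :> R).
    by rewrite !ler_int tr' (ltW rq).
  have tqR : t.1%:~R < q.1%:~R :> R by rewrite ltr_int; lia.
  have := top_chord gK Kt tq.1 tqR trR tr.
  rewrite -!intrB -!intrM ler_int => H; lia.
have := B2 t Kt; rewrite (ltW rt) tq' => /(_ isT) H2.
have := B1 p tp.1; rewrite (ltW pr) lexx => /(_ isT) H1.
have trR : (p.1%:~R <= r.1%:~R :> R) && (r.1%:~R <= t.1%:~R :> R).
  by rewrite !ler_int (ltW pr) (ltW rt).
have tqR : p.1%:~R < t.1%:~R :> R by rewrite ltr_int; lia.
have := top_chord gK tp.1 Kt tqR trR tr.
rewrite -!intrB -!intrM ler_int => H; lia.
Qed.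

(** Each piece of the upper boundary contributes its left end, so two pieces give two lattice
    points; a single piece has all of [K] below its line. *)
Lemma intcols_hull (p q : int * int) : topz K p -> topz K q -> p.1 < q.1 ->
  (2 <= intcols K p.1 `|q.1 - p.1|%N)%N \/
  (forall x y, K x y -> (y - p.2%:~R) * (q.1%:~R - p.1%:~R)
              <= (q.2%:~R - p.2%:~R) * (x - p.1%:~R)).
Proof.
have ge1 (a b : int * int) : topz K a -> a.1 < b.1 ->
    (1 <= intcols K a.1 `|b.1 - a.1|%N)%N.
  move=> ta ab; have -> : `|b.1 - a.1|%N = (1 + `|b.1 - a.1|.-1)%N by lia.
  by rewrite intcolsD /intcols big_ord1 addr0 (upperE ta) intr_int.
move: p q; refine (hull_ind gK _ _) => [p q tp tq pq below|p r q tp tr tq pr rq _ _]; first by right.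
left; have -> : (`|q.1 - p.1| = `|r.1 - p.1| + `|q.1 - r.1|)%N by lia.
have rE : p.1 + `|r.1 - p.1|%N%:Z = r.1 by lia.
by rewrite intcolsD rE; apply: (@leq_add 1 1); apply: ge1.
Qed.

End FloorSums.

(** * Unimodular maps, vertical strips and counting by columns *)

Section Strip.
Variable R : realType.
Implicit Types (K : R -> R -> Prop) (S : seq (int * int)).

Definition lin K (a b c d : int) : R -> R -> Prop :=
  fun x y => K (a%:~R * x + b%:~R * y) (c%:~R * x + d%:~R * y).

(** The image of [s] under the inverse matrix: for determinant 1 or -1 this is the determinant times
    the adjugate. *)
Definition adj_pt (a b c d : int) (s : int * int) : int * int :=
  ((a * d - b * c) * (d * s.1 - b * s.2), (a * d - b * c) * (a * s.2 - c * s.1)).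

Lemma gen_convex_lin K S (a b c d : int) :
  gen_convex K S -> (a * d - b * c) ^+ 2 = 1 ->
  gen_convex (lin K a b c d) (map (adj_pt a b c d) S).
Proof.
move=> [Kc KS Ki Kp] det1.
pose e : R := (a * d - b * c)%:~R.
have eE : e = a%:~R * d%:~R - b%:~R * c%:~R by rewrite /e !(intrB, intrM).
have e2 : e * e = 1 by rewrite -intrM -expr2 det1.
have invK x y : lin K a b c d (e * (d%:~R * x - b%:~R * y)) (e * (a%:~R * y - c%:~R * x)) = K x y.
  rewrite /lin; congr (K _ _).
    by apply: (etrans (y := e * e * x)); [rewrite eE; ring | rewrite e2 mul1r].
  by apply: (etrans (y := e * e * y)); [rewrite eE; ring | rewrite e2 mul1r].
have coordE x y : x = e * (d%:~R * (a%:~R * x + b%:~R * y) - b%:~R * (c%:~R * x + d%:~R * y)) /\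
   y = e * (a%:~R * (c%:~R * x + d%:~R * y) - c%:~R * (a%:~R * x + b%:~R * y)).
  split.
    by apply: (etrans (y := e * e * x)); [rewrite e2 mul1r | rewrite eE; ring].
  by apply: (etrans (y := e * e * y)); [rewrite e2 mul1r | rewrite eE; ring].
have adjE s : (adj_pt a b c d s).1%:~R = e * (d%:~R * s.1%:~R - b%:~R * s.2%:~R) /\
    (adj_pt a b c d s).2%:~R = e * (a%:~R * s.2%:~R - c%:~R * s.1%:~R).
  by rewrite /e /adj_pt /= !(intrM, intrB).
split.
- move=> x y x' y' t; rewrite /lin => Kxy Kxy' t01.
  have := Kc _ _ _ _ t Kxy Kxy' t01; congr (K _ _); ring.
- by move=> _ /mapP[s sS ->]; case: (adjE s) => -> ->; rewrite invK; apply: KS.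
- move=> al be c0 H x y /Ki Kxy; have [-> ->] := coordE x y.
  have := Kxy (e * (al * d%:~R - be * c%:~R)) (e * (be * a%:~R - al * b%:~R)) c0.
  move=> {}Kxy; have {}Kxy := Kxy _.
  suff /Kxy : forall s, s \in S -> e * (al * d%:~R - be * c%:~R) * s.1%:~R +
     e * (be * a%:~R - al * b%:~R) * s.2%:~R <= c0.
    by congr (_ <= _); ring.
  move=> s /(map_f (adj_pt a b c d)) /H; case: (adjE s) => -> ->.
  by congr (_ <= _); ring.
- move=> al be c0 H.
  have [|A B] := Kp (e * (al * d%:~R - be * c%:~R)) (e * (be * a%:~R - al * b%:~R)) c0.
    by move=> x y; rewrite -invK => /H <-; ring.
  have e0 : e != 0.
    by apply/eqP => e0; move: e2; rewrite e0 mul0r => /eqP; rewrite eq_sym oner_eq0.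
  move: A B => /eqP; rewrite mulf_eq0 (negPf e0) /= => /eqP A.
  move=> /eqP; rewrite mulf_eq0 (negPf e0) /= => /eqP B.
  have al0 : e * al = 0.
    have -> : e * al = a%:~R * (al * d%:~R - be * c%:~R) + c%:~R * (be * a%:~R - al * b%:~R).
      by rewrite eE; ring.
    by rewrite A B; ring.
  have be0 : e * be = 0.
    have -> : e * be = b%:~R * (al * d%:~R - be * c%:~R) + d%:~R * (be * a%:~R - al * b%:~R).
      by rewrite eE; ring.
    by rewrite A B; ring.
  by split; apply: (mulfI e0); rewrite mulr0.
Qed.

Definition flip K : R -> R -> Prop := fun x y => K x (- y).

Lemma flip_lin K : lin K 1 0 0 (-1) = flip K.
Proof.
by apply/funext => x; apply/funext => y; rewrite /lin /flip; congr (K _ _); ring.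
Qed.

Lemma gen_flip K S : gen_convex K S -> exists S', gen_convex (flip K) S'.
Proof.
move=> gK; exists (map (adj_pt 1 0 0 (-1)) S).
by rewrite -flip_lin; apply: gen_convex_lin.
Qed.

Lemma gen_nonnil K S : gen_convex K S -> S != [::].
Proof.
move=> gK; apply/eqP => S0; have K0 x y : ~ K x y.
  move=> /(gc_ineq gK (a := 0) (b := 0) (c := -1)); rewrite S0 !mul0r add0r => H.
  by have : (0 : R) <= -1 by [exact: H]; lra.
have [/eqP] : (1 : R) = 0 /\ (0 : R) = 0.
  by apply: (gc_plane gK (c := 0)) => x y /K0.
by rewrite oner_eq0.
Qed.

Lemma ex_left K S : gen_convex K S ->
  exists2 p, topz K p & forall x y, K x y -> p.1%:~R <= x.
Proof.
move=> gK; have S0 := gen_nonnil gK.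
have [b bS bP] : exists2 b : int * int, b \in S & forall s, s \in S -> `|s.2|%N%:Z <= `|b.2|%N%:Z.
  exact: (argmax_seq (fun s : int * int => `|s.2|%N%:Z)).
(* [M] exceeds all differences of ordinates, so maximizing [s.2 - M * s.1] picks the highest among
   the leftmost generators. *)
set M : int := 2 * `|b.2|%N%:Z + 1.
have [r rS rP] : exists2 r : int * int, r \in S &
    forall s, s \in S -> s.2 - M * s.1 <= r.2 - M * r.1.
  exact: (argmax_seq (fun s : int * int => s.2 - M * s.1)).
have rmin (s : int * int) : s \in S -> r.1 <= s.1.
  move=> sS; rewrite leNgt; apply/negP => sr.
  have rs0 : 0 <= M * (r.1 - s.1 - 1) by apply: mulr_ge0; rewrite /M; lia.
  have ME : M = 2 * `|b.2|%N%:Z + 1 by [].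
  have H1 := bP s sS; have H2 := bP r rS; have H3 := rP s sS.
  clear -rs0 ME H1 H2 H3; clearbody M; move: rs0 ME H1 H2 H3.
  by case: s => s1 s2; case: r => r1 r2; case: b => b1 b2 /=; lia.
exists r; last first.
  move=> x y /(gc_ineq gK (a := -1) (b := 0) (c := - r.1%:~R)) H.
  have {}H := H _; suff /H : forall s, s \in S -> -1 * s.1%:~R + 0 * s.2%:~R <= - r.1%:~R :> R.
    by rewrite mul0r addr0 mulN1r lerN2.
  by move=> s /rmin sr; rewrite mul0r addr0 mulN1r lerN2 ler_int.
split; first exact: (gc_gen gK).
move=> z /(gc_ineq gK (a := - M%:~R) (b := 1) (c := r.2%:~R - M%:~R * r.1%:~R)) H.
have {}H := H _; suff /H : forall s, s \in S ->
    - M%:~R * s.1%:~R + 1 * s.2%:~R <= r.2%:~R - M%:~R * r.1%:~R :> R by rewrite mulNr mul1r; lra.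
move=> s /rP; rewrite -(ler_int R) !(intrB, intrM) => sr.
by rewrite mulNr mul1r addrC.
Qed.

Lemma ex_right K S : gen_convex K S ->
  exists2 p, topz K p & forall x y, K x y -> x <= p.1%:~R.
Proof.
move=> gK; have := gen_convex_lin (a := -1) (b := 0) (c := 0) (d := 1) gK erefl.
have E x y : lin K (-1) 0 0 1 x y = K (- x) y by rewrite /lin; congr (K _ _); ring.
move=> /ex_left[[p1 p2] [Kp pP] pmin]; exists (- p1, p2) => /=.
  split=> [|z]; move: Kp; rewrite /= E -intrN // => _ Kz.
  by apply: pP; rewrite /= E -intrN.
by move=> x y; rewrite -[x]opprK -E => /pmin /=; rewrite intrN lerNr opprK lerNr.
Qed.

(* The heights ua, ub are those of the upper corners over both end columns; va, vb are the
   opposites of the heights of the lower corners, i.e. the upper corners of flip K. *)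
Record strip K (a : int) (W : nat) (ua ub va vb : int) : Prop := Strip {
  st_W : (0 < W)%N;
  st_in : forall x y, K x y -> a%:~R <= x <= (a + W%:Z)%:~R;
  st_ua : topz K (a, ua);
  st_ub : topz K (a + W%:Z, ub);
  st_va : topz (flip K) (a, va);
  st_vb : topz (flip K) (a + W%:Z, vb) }.

Lemma strip_ex K S : gen_convex K S -> exists a W ua ub va vb, strip K a W ua ub va vb.
Proof.
move=> gK; have [S' gK'] := gen_flip gK.
have [[a ua] tua amin] := ex_left gK; have [[b ub] tub bmax] := ex_right gK.
have [[a' va] tva amin'] := ex_left gK'; have [[b' vb] tvb bmax'] := ex_right gK'.
have aa : a' = a.
  have /= := amin' _ (- ua%:~R); rewrite /flip opprK => /(_ _ tua.1); rewrite ler_int /= => H1.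
  have /= := amin _ _ tva.1; rewrite ler_int /= => H2. lia.
have bb : b' = b.
  have /= := bmax' _ (- ub%:~R); rewrite /flip opprK => /(_ _ tub.1); rewrite ler_int /= => H1.
  have /= := bmax _ _ tvb.1; rewrite ler_int /= => H2; lia.
move: tva tvb; rewrite aa bb => tva tvb.
(* Otherwise [K] would lie on a vertical line, against [gc_plane]. *)
have ab : a < b.
  rewrite ltNge; apply/negP => ba.
  have [/eqP] : (1 : R) = 0 /\ (0 : R) = 0.
    apply: (gc_plane gK (c := a%:~R)) => x y Kxy; rewrite mul0r addr0 mul1r.
    by apply/eqP; rewrite eq_le (amin _ _ Kxy) (le_trans (bmax _ _ Kxy)) // ler_int.
  by rewrite oner_eq0.
have E : a + `|b - a|%N%:Z = b by lia.
exists a, `|b - a|%N, ua, ub, va, vb; split; rewrite ?E //; first lia.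
by move=> x y Kxy; rewrite (amin _ _ Kxy) (bmax _ _ Kxy).
Qed.

(* The algebraic interior: manifestly invariant under linear maps. *)
Definition core K x y := forall dx dy : R, exists e, 0 < e /\ K (x + e * dx) (y + e * dy).

Definition npoints (D : set (int * int)) : nat := #|` fset_set D|.

Lemma npoints_seq (D : set (int * int)) (L : seq (int * int)) : uniq L ->
  (forall z, D z <-> z \in L) -> npoints D = size L.
Proof.
move=> uL DL; rewrite /npoints.
have -> : D = [set` [fset z in L]%fset].
  by apply/seteqP; split=> z /=; rewrite in_fset => /DL.
by rewrite set_fsetK card_fseq undup_id.
Qed.

Lemma npoints_columns (D : set (int * int)) (a : int) (N : nat) (lo hi : nat -> int) :
  (forall i, (i < N)%N -> lo i <= hi i) ->
  (forall z, D z <-> exists i : nat, [/\ (i < N)%N, z.1 = a + i%:Z & lo i <= z.2 < hi i]) ->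
  (npoints D)%:Z = \sum_(i < N) (hi i - lo i).
Proof.
move=> lohi DP.
pose f (i j : nat) : int * int := (a + i%:Z, lo i + j%:Z).
rewrite (@npoints_seq D [seq f i j | i <- iota 0 N, j <- iota 0 `|hi i - lo i|]).
- have iotaE : iota 0 N = index_iota 0 N by rewrite /index_iota subn0.
  rewrite size_allpairs_dep sumnE big_map iotaE big_mkord -natz natr_sum; apply: eq_bigr => i _.
  by rewrite size_iota natz; have := lohi i (ltn_ord i); lia.
- apply: allpairs_uniq_dep => [|i _|]; rewrite ?iota_uniq //.
  move=> [i j] [i' j'] _ _; rewrite /f /= => -[E1 E2].
  have ii : i = i' by lia.
  by rewrite ii in E2 *; congr (existT _ _ _); lia.
- move=> [x y]; split.
    move=> /DP[i [iN /= xE yin]]; apply/allpairsPdep; exists i, `|y - lo i|%N.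
    by rewrite !mem_iota /f; split; [lia|lia|congr pair; lia].
  move=> /allpairsPdep[i [j []]]; rewrite !mem_iota => iN jN [-> ->].
  by apply/DP; exists i; split => //=; have := lohi i; lia.
Qed.

End Strip.

(** * Interior and boundary lattice points *)

Section Pick.
Variable R : realType.
Variables (K : R -> R -> Prop) (S : seq (int * int)).
Hypothesis gK : gen_convex K S.

Definition lattice_count (k : nat) : nat :=
  npoints [set z : int * int | K (z.1%:~R / k%:R) (z.2%:~R / k%:R)].

Definition core_count : nat := npoints [set z : int * int | core K z.1%:~R z.2%:~R].

(** For the sets at hand, [bd_countE] shows that the subtraction does not truncate. *)
Definition bd_count : nat := (lattice_count 1 - core_count)%N.

Lemma convexE x1 y1 x2 y2 t x y : K x1 y1 -> K x2 y2 -> 0 <= t <= 1 ->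
  x = t * x1 + (1 - t) * x2 -> y = t * y1 + (1 - t) * y2 -> K x y.
Proof. by move=> K1 K2 t01 -> ->; apply: (gc_convex gK). Qed.

Lemma convex_vert x y1 y2 y : K x y1 -> K x y2 -> y1 <= y <= y2 -> K x y.
Proof.
move=> K1 K2 /andP[y1y yy2]; have [y12|y12] := eqVneq y1 y2.
  have -> // : y = y1 by apply/eqP; rewrite eq_le y1y y12 yy2.
have d0 : 0 < y2 - y1 by rewrite subr_gt0 lt_neqAle y12 (le_trans y1y).
apply: (convexE (t := (y - y1) / (y2 - y1)) K2 K1).
- by rewrite divr_ge0 ?subr_ge0 ?(le_trans y1y) //= ler_pdivrMr ?mul1r ?lerB.
- by ring.
- by field; rewrite lt0r_neq0.
Qed.

Lemma convex_horiz y x1 x2 x : K x1 y -> K x2 y -> x1 <= x <= x2 -> K x y.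
Proof.
move=> K1 K2 /andP[x1x xx2]; have [x12|x12] := eqVneq x1 x2.
  have -> // : x = x1 by apply/eqP; rewrite eq_le x1x x12 xx2.
have d0 : 0 < x2 - x1 by rewrite subr_gt0 lt_neqAle x12 (le_trans x1x).
apply: (convexE (t := (x - x1) / (x2 - x1)) K2 K1).
- by rewrite divr_ge0 ?subr_ge0 ?(le_trans x1x) //= ler_pdivrMr ?mul1r ?lerB.
- by field; rewrite lt0r_neq0.
- by ring.
Qed.

(** The point lies on a segment from the horizontal tip of the cross on the side of [dx] to a point
    of its vertical axis. *)
Lemma convex_cross d x y dx dy : K (x - d) y -> K (x + d) y ->
  K x (y - d) -> K x (y + d) -> `|dx| + `|dy| < d -> K (x + dx) (y + dy).
Proof.
move=> Kl Kr Kd Ku dxy.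
have dx0 := normr_ge0 dx; have dy0 := normr_ge0 dy.
have d0 : 0 < d by lra.
have r0 : 0 < d - `|dx| by lra.
have Kx : K (x + Num.sg dx * d) y.
  by case: (sgrP dx) => _; [|rewrite mul1r|rewrite mulN1r] => //;
    rewrite mul0r addr0; apply: (convex_vert Kd Ku); lra.
have s1 : -1 <= dy / (d - `|dx|) <= 1.
  have := ler_norm dy; have := ler_norm (- dy); rewrite normrN => *.
  by rewrite ler_pdivlMr // ler_pdivrMr //; apply/andP; split; lra.
have Ky : K x (y + d * dy / (d - `|dx|)).
  apply: (convex_vert Kd Ku); rewrite -mulrA lerD2l lerD2l.
  case/andP: s1 => sl su; apply/andP; split; last by rewrite ger_pMr.
  by rewrite -mulrN1 ler_pM2l.
apply: (convexE (t := `|dx| / d) Kx Ky).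
- by rewrite divr_ge0 ?(ltW d0) //= ler_pdivrMr ?mul1r //; lra.
- rewrite {1}[dx]numEsg; field; exact: lt0r_neq0.
- by field; rewrite !lt0r_neq0.
Qed.

Lemma core_cross d x y : 0 < d -> K (x - d) y -> K (x + d) y ->
  K x (y - d) -> K x (y + d) -> core K x y.
Proof.
move=> d0 Kl Kr Kd Ku dx dy.
have n0 : 0 < `|dx| + `|dy| + 1 by have := normr_ge0 dx; have := normr_ge0 dy; lra.
exists (d / (`|dx| + `|dy| + 1)); split; first exact: divr_gt0.
apply: (convex_cross Kl Kr Kd Ku); have q0 := divr_gt0 d0 n0.
rewrite (normrM _ dx) (normrM _ dy) (gtr0_norm q0) -mulrDr mulrAC ltr_pdivrMr //.
by rewrite ltr_pM2l //; lra.
Qed.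

(* Tilting the segment from (x, y') to (xa, ya), with y' near y, until it passes at height y. *)
Lemma horiz_step x y e xa ya : 0 < e -> K x (y - e) -> K x (y + e) -> K xa ya ->
  exists2 t, 0 < t < 1 & K (x + t * (xa - x)) y.
Proof.
move=> e0 Kd Ku Ka; have n0 := normr_ge0 (ya - y).
set D := e + `|ya - y| + 1; have D0 : 0 < D by rewrite /D; lra.
have t01 : 0 < e / D < 1 by rewrite divr_gt0 //= ltr_pdivrMr // mul1r /D; lra.
exists (e / D) => //.
set y' := (y - e / D * ya) / (1 - e / D).
have De : 0 < D - e by rewrite /D; lra.
have y'E : y' = y - e * (ya - y) / (D - e).
  by rewrite /y'; field; rewrite !lt0r_neq0.
have Ky' : K x y'.
  apply: (convex_vert Kd Ku); rewrite y'E lerD2l -mulrA lerD2l.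
  have := ler_norm (ya - y); have := ler_norm (- (ya - y)); rewrite normrN => *.
  apply/andP; split; last first.
    rewrite lerNl -mulrN1 ler_pM2l // ler_pdivlMr // /D; lra.
  by rewrite lerN2 ger_pMr // ler_pdivrMr // mul1r /D; lra.
apply: (convexE (t := e / D) Ka Ky').
- by case/andP: t01 => /ltW-> /ltW->.
- by ring.
- by rewrite /y' [(1 - _) * _]mulrC divfK; [ring|case/andP: t01 => _ t1; rewrite subr_eq0 eq_sym lt_eqF].
Qed.

(** Tilting towards the points on either side gives points of [K] to the left and to the right at
    height [y]; together with the vertical segment they form a cross. *)
Lemma core_surrounded x y e xa ya xb yb : 0 < e -> K x (y - e) -> K x (y + e) ->
  K xa ya -> K xb yb -> xa < x < xb -> core K x y.
Proof.
move=> e0 Kd Ku Ka Kb /andP[xax xxb].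
have [t1 /andP[t10 t11] K1] := horiz_step e0 Kd Ku Ka.
have [t2 /andP[t20 t21] K2] := horiz_step e0 Kd Ku Kb.
set dl := t1 * (x - xa); set dr := t2 * (xb - x).
have dl0 : 0 < dl by rewrite mulr_gt0 // subr_gt0.
have dr0 : 0 < dr by rewrite mulr_gt0 // subr_gt0.
have K1' : K (x - dl) y by move: K1; congr (K _ _); rewrite /dl; ring.
set d := Num.min e (Num.min dl dr).
have [de [ddl ddr]] : d <= e /\ d <= dl /\ d <= dr.
  by rewrite /d !ge_min !lexx !orbT.
have d0 : 0 < d by rewrite /d !lt_min e0 dl0 dr0.
apply: (core_cross (d := d)) => //.
- by apply: (convex_horiz K1' K2); rewrite -/dr; lra.
- by apply: (convex_horiz K1' K2); rewrite -/dr; lra.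
- by apply: (convex_vert Kd Ku); lra.
- by apply: (convex_vert Kd Ku); lra.
Qed.

(** * Columns of a strip and their lattice points *)

Section InStrip.
Variables (a : int) (W : nat) (ua ub va vb : int).
Hypothesis st : strip K a W ua ub va vb.

Local Notation u := (upper K).
Local Notation v := (upper (flip K)).
Local Notation inab x := (a%:~R <= x <= (a + W%:Z)%:~R).

Lemma strip_lt : a < a + W%:Z.
Proof. by rewrite ltrDl ltz_nat (st_W st). Qed.

Lemma top_u x : inab x -> top K x (u x).
Proof.
move=> /(top_supp gK (st_ua st) (st_ub st) strip_lt)[y [h [t _]]].
by rewrite (upperE t).
Qed.

Lemma top_v x : inab x -> top (flip K) x (v x).
Proof.
have [S' gK'] := gen_flip gK.
move=> /(top_supp gK' (st_va st) (st_vb st) strip_lt)[y [h [t _]]].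
by rewrite (upperE t).
Qed.

Lemma strip_between x y : inab x -> K x y <-> - v x <= y <= u x.
Proof.
move=> xin; have [Ku uP] := top_u xin; have [Kv vP] := top_v xin; split.
  move=> Kxy; rewrite uP // lerNl vP //.
  by rewrite /flip opprK.
exact: convex_vert.
Qed.

Lemma strip_le x : inab x -> - v x <= u x.
Proof.
by move=> xin; have [Ku _] := top_u xin; have /strip_between-/(_ xin)/andP[] := Ku.
Qed.

(** A point outside lies beyond one of the end columns or beyond a supporting line of the upper or
    lower boundary. Closedness of polygons follows from this. *)
Lemma strip_separate x y : ~ K x y -> exists al be c : R,
  (forall x' y', K x' y' -> al * x' + be * y' <= c) /\ c < al * x + be * y.
Proof.
move=> nK; have [xa|xa] := ltP x a%:~R.
  exists (-1), 0, (- a%:~R); rewrite !mul0r !addr0 !mulN1r ltrN2; split=> // x' y'.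
  by move=> /(st_in st)/andP[+ _]; rewrite mul0r addr0 mulN1r lerN2.
have [xb|xb] := ltP (a + W%:Z)%:~R x.
  exists 1, 0, ((a + W%:Z)%:~R); rewrite !mul0r !addr0 !mul1r; split=> // x' y'.
  by move=> /(st_in st)/andP[_]; rewrite mul0r addr0 mul1r.
have xin : inab x by rewrite xa xb.
have [yu|yu] := ltP (u x) y.
  have [y0 [h [t hP]]] := top_supp gK (st_ua st) (st_ub st) strip_lt xin.
  exists (- h), 1, (y0 - h * x); split; last by rewrite -(upperE t); lra.
  by move=> x' y' /hP; lra.
have [yv|yv] := ltP (v x) (- y).
  have [S' gK'] := gen_flip gK.
  have [y0 [h [t hP]]] := top_supp gK' (st_va st) (st_vb st) strip_lt xin.
  exists (- h), (-1), (y0 - h * x); split.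
    by move=> x' y'; rewrite -[y' in K _ y']opprK => /hP; lra.
  by rewrite -(upperE t); lra.
by case: nK; apply/(strip_between _ xin); rewrite lerNl yv yu.
Qed.

(* If the slice over an interior abscissa were a point, the whole set would lie on a line. *)
Lemma strip_nondeg x : a%:~R < x < (a + W%:Z)%:~R -> - v x < u x.
Proof.
move=> /andP[ax xb]; have xin : inab x by rewrite !ltW.
rewrite lt_neqAle strip_le // andbT; apply/negP => /eqP vu.
set z := u x; set b : R := (a + W%:Z)%:~R in xb xin *.
have only y : K x y -> y = z.
  by move=> /(strip_between _ xin); rewrite vu => H; apply/eqP; rewrite eq_le andbC.
have chord x1 y1 x2 y2 : K x1 y1 -> K x2 y2 -> x1 < x < x2 ->
    (y2 - y1) * (x - x1) = (z - y1) * (x2 - x1).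
  move=> K1 K2 /andP[x1x xx2].
  have x12 : x1 < x2 by apply: lt_trans xx2.
  have := convex_chord gK K1 K2 x12 (x := x); rewrite !ltW // => /(_ isT)/only <-.
  by field; rewrite subr_eq0 gt_eqF.
have [] : - ((ub%:~R : R) - z) = 0 /\ b - x = 0; last by lra.
have Ka : K a%:~R ua%:~R := (st_ua st).1.
have Kb : K b ub%:~R := (st_ub st).1.
apply: (gc_plane gK (c := (b - x) * z - (ub%:~R - z) * x)) => x' y' Kxy'.
suff : (y' - z) * (b - x) = (ub%:~R - z) * (x' - x) by move=> H; lra.
have [x'x|xx'|x'x] := ltgtP x' x.
- have H := chord _ _ _ _ Kxy' Kb; rewrite x'x xb in H; have {}H := H isT; lra.
- have xa0 : x - a%:~R != 0 by rewrite subr_eq0 gt_eqF.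
  apply: (mulIf xa0).
  have H1 := chord _ _ _ _ Ka Kxy'; rewrite ax xx' in H1; have {}H1 := H1 isT.
  have H2 := chord _ _ _ _ Ka Kb; rewrite ax xb in H2; have {}H2 := H2 isT.
  transitivity ((z - ua%:~R) * (x' - x) * (b - x)).
    transitivity (((y' - ua%:~R) * (x - a%:~R) - (z - ua%:~R) * (x - a%:~R)) * (b - x)); first by ring.
    by rewrite H1; ring.
  transitivity (((ub%:~R - ua%:~R) * (x - a%:~R) - (z - ua%:~R) * (x - a%:~R)) * (x' - x)); last by ring.
  by rewrite H2; ring.
- by move: Kxy'; rewrite x'x => /only ->; rewrite !subrr mul0r mulr0.
Qed.

Lemma strip_core x y : core K x y <->
  a%:~R < x < (a + W%:Z)%:~R /\ - v x < y < u x.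
Proof.
split=> [cK|[xin /andP[vy yu]]]; last first.
  have xin' : inab x by case/andP: xin => *; rewrite !ltW.
  set e := Num.min (y + v x) (u x - y).
  have [e1 e2] : e <= y + v x /\ e <= u x - y by rewrite /e !ge_min !lexx orbT.
  have e0 : 0 < e by rewrite lt_min; apply/andP; split; lra.
  apply: (core_surrounded e0 _ _ (st_ua st).1 (st_ub st).1 xin);
    by apply/(strip_between _ xin'); lra.
have sh (dx dy : R) : exists e, 0 < e /\ K (x + e * dx) (y + e * dy) by apply: cK.
have [e1 [e10 /(st_in st)/andP[_ H1]]] := sh 1 0.
have [e2 [e20 /(st_in st)/andP[H2 _]]] := sh (-1) 0.
have xin : a%:~R < x < (a + W%:Z)%:~R by apply/andP; split; lra.
have xin' : inab x by case/andP: xin => *; rewrite !ltW.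
split=> //; have [e3 [e30]] := sh 0 1; rewrite mulr0 addr0 mulr1.
move=> /(strip_between _ xin')/andP[_ H3].
have [e4 [e40]] := sh 0 (-1); rewrite mulr0 addr0 mulrN1.
move=> /(strip_between _ xin')/andP[H4 _].
by apply/andP; split; lra.
Qed.

(** A column has as many points as the sum of its two floors plus 1. The last one is outside the
    range of [floorsum] and contributes [k (ub + vb) + 1]. *)
Lemma lattice_countE k : (0 < k)%N -> (lattice_count k)%:Z =
  floorsum K k a W + floorsum (flip K) k a W + (k * W)%N%:Z + k%:Z * (ub + vb) + 1.
Proof.
move=> k0; have k0R : 0 < k%:R :> R by rewrite ltr0n.
pose X i : R := (k%:Z * a + i%:Z)%:~R / k%:R.
have Xin i : (i < (k * W).+1)%N -> inab (X i).
  move=> ik; rewrite ler_pdivlMr // ler_pdivrMr // -[k%:R]/((k%:Z)%:~R) -!intrM !ler_int.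
  by apply/andP; split; lia.
have betw i y : (i < (k * W).+1)%N -> K (X i) (y%:~R / k%:R) <->
    - Num.floor (k%:R * v (X i)) <= y < Num.floor (k%:R * u (X i)) + 1.
  move=> ik; apply: (iff_trans (strip_between _ (Xin _ ik))).
  rewrite ltzD1 [- Num.floor _ <= _]lerNl !floor_ge_int intrN ler_pdivlMr // ler_pdivrMr //.
  by split=> /andP[? ?]; apply/andP; split; lra.
rewrite (@npoints_columns _ (k%:Z * a) (k * W).+1
  (fun i => - Num.floor (k%:R * v (X i))) (fun i => Num.floor (k%:R * u (X i)) + 1)).
- rewrite big_ord_recr /=.
  have -> : X (k * W)%N = (a + W%:Z)%:~R.
    rewrite /X PoszM -mulrDr intrM [_%:~R * _]mulrC mulfK //; exact: lt0r_neq0.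
  rewrite (upperE (st_ub st)) (upperE (st_vb st)) /=.
  rewrite -[k%:R]/((k%:Z)%:~R) -!intrM !intrKfloor.
  rewrite (eq_bigr (fun i : 'I_(k * W) =>
    Num.floor (k%:R * u (X i)) + Num.floor (k%:R * v (X i)) + 1)) => [|i _]; last by ring.
  rewrite !big_split /= sumr_const card_ord natz.
  rewrite /floorsum /X; ring.
- move=> i ik; have := strip_le (Xin i ik); rewrite -(ler_pM2l k0R) mulrN => H.
  have H1 := floorD1_gt (k%:R * v (X i)); have H2 := floorD1_gt (k%:R * u (X i)).
  have : (-1 : R) < (Num.floor (k%:R * u (X i)) + 1 + Num.floor (k%:R * v (X i)))%:~R.
    move: H1 H2; rewrite !intrD; lra.
  by rewrite -[-1]/((-1)%:~R) ltr_int; lia.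
- move=> [x y] /=; split.
    move=> Kxy; have /andP[] := st_in st Kxy; rewrite ler_pdivlMr // ler_pdivrMr //.
    rewrite -[k%:R]/((k%:Z)%:~R) -!intrM !ler_int => xl xu.
    have xE : x = k%:Z * a + (absz (x - k%:Z * a)%R)%:Z by lia.
    have ik : (absz (x - k%:Z * a)%R < (k * W).+1)%N by lia.
    exists (absz (x - k%:Z * a)%R); split=> //.
    by apply/(betw _ _ ik); rewrite /X -xE.
  by move=> [i [ik -> /(betw _ _ ik)]].
Qed.

(** All lattice points of the column less those at its two ends, which are distinct over inner
    abscissas by [strip_nondeg]. *)
Definition core_column (i : nat) : int :=
  Num.floor (u (a + i%:Z)%:~R) + Num.floor (v (a + i%:Z)%:~R) + 1
  - (u (a + i%:Z)%:~R \is a Num.int)%:Z - (v (a + i%:Z)%:~R \is a Num.int)%:Z.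

Lemma core_countE : core_count%:Z = \sum_(1 <= i < W) core_column i.
Proof.
pose X i : R := (a + i%:Z)%:~R.
have Xin i : (0 < i < W)%N -> a%:~R < X i < (a + W%:Z)%:~R.
  by move=> iW; rewrite /X !ltr_int; apply/andP; split; lia.
have ceilE (x : R) : Num.ceil x = Num.floor x + 1 - (x \is a Num.int)%:Z.
  rewrite ceil_floor; case: (x \is a Num.int); rewrite /= ?addr0 ?subr0 ?addrK //; lia.
rewrite big_add1 big_mkord.
rewrite /core_count (@npoints_columns _ (a + 1) W.-1
  (fun i => Num.floor (- v (X i.+1)) + 1) (fun i => Num.ceil (u (X i.+1)))).
- apply: eq_bigr => i _; rewrite (floorNceil (- v (X i.+1))) opprK.
  rewrite !ceilE /core_column /X; lia.
- move=> i iW; have /Xin/strip_nondeg H : (0 < i.+1 < W)%N by lia.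
  by rewrite lezD1 floor_lt_int; apply: lt_le_trans H (ceil_ge _).
- move=> [x y] /=; split.
    move=> /strip_core[/andP[]]; rewrite !ltr_int => xl xu /andP[yl yu].
    exists (`|x - a|.-1)%N.
    have xE : x = a + (`|x - a|.-1.+1)%N%:Z by lia.
    split; [lia|lia|].
    by rewrite /X -xE lezD1 floor_lt_int ceil_gt_int yl yu.
  move=> [i [iW -> /andP[yl yu]]]; apply/strip_core.
  have E : a + 1 + i%:Z = a + i.+1%:Z by lia.
  rewrite E; split; first by apply: Xin; lia.
  by rewrite -floor_lt_int -ceil_gt_int -lezD1 yl yu.
Qed.

Lemma intcols_recl : intcols K a W =
  (1 + \sum_(1 <= i < W) (u (a + i%:Z)%:~R \is a Num.int))%N.
Proof.
rewrite /intcols -(big_mkord xpredT (fun i => (u (a + i%:Z)%:~R \is a Num.int) : nat)).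
by rewrite big_ltn ?(st_W st) // addr0 (upperE (st_ua st)) intr_int.
Qed.

Lemma intcols_recl_flip : intcols (flip K) a W =
  (1 + \sum_(1 <= i < W) (v (a + i%:Z)%:~R \is a Num.int))%N.
Proof.
rewrite /intcols -(big_mkord xpredT (fun i => (v (a + i%:Z)%:~R \is a Num.int) : nat)).
by rewrite big_ltn ?(st_W st) // addr0 (upperE (st_va st)) intr_int.
Qed.

Lemma side_ge0 : 0 <= ua + va /\ 0 <= ub + vb.
Proof.
have := strip_le (x := a%:~R); have := strip_le (x := (a + W%:Z)%:~R).
rewrite !lexx !ler_int (ltW strip_lt) => /(_ isT) + /(_ isT).
rewrite (upperE (st_ua st)) (upperE (st_ub st)) (upperE (st_va st)) (upperE (st_vb st)) /=.
by rewrite -!intrN !ler_int; lia.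
Qed.

(** The end columns consist of [ua + va + 1] and [ub + vb + 1] boundary points, and an inner column
    has one for each integral end. The two extra ones are accounted for by the left corners, which
    the [intcols] terms include. *)
Lemma bd_countE : lattice_count 1 = (core_count + bd_count)%N /\
  bd_count%:Z = (ua + va) + (ub + vb) + (intcols K a W)%:Z + (intcols (flip K) a W)%:Z.
Proof.
have fsum (F : R -> R -> Prop) : floorsum F 1 a W =
    Num.floor (upper F a%:~R) + \sum_(1 <= i < W) Num.floor (upper F (a + i%:Z)%:~R).
  rewrite /floorsum mul1n.
  rewrite -(big_mkord xpredT (fun i => Num.floor (1%:R * upper F ((1 * a + i%:Z)%:~R / 1%:R)))).
  rewrite big_ltn ?(st_W st) // divr1 !mul1r addr0; congr (_ + _).
  by apply: eq_bigr => i _; rewrite divr1 !mul1r.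
have natsum (F : nat -> bool) :
    (\sum_(1 <= i < W) F i)%N%:Z = \sum_(1 <= i < W) (F i)%:Z.
  by rewrite -natz natr_sum; apply: eq_bigr => i _; rewrite natz.
have E : (lattice_count 1)%:Z = core_count%:Z +
    ((ua + va) + (ub + vb) + (intcols K a W)%:Z + (intcols (flip K) a W)%:Z).
  rewrite lattice_countE // mul1n core_countE !fsum intcols_recl intcols_recl_flip /core_column.
  rewrite !sumrB !big_split /= (upperE (st_ua st)) (upperE (st_va st)) !intrKfloor.
  rewrite !PoszD !natsum sumr_const_nat natz; have W0 := st_W st; rewrite -[(a, ua).2]/ua -[(a, va).2]/va.
  have -> : (W - 1)%N%:Z = W%:Z - 1 by lia.
  by ring.
have [s1 s2] := side_ge0.
by rewrite /bd_count; split; lia.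
Qed.

Lemma floorsum_strip : exists al : int,
  (forall k, (0 < k)%N -> floorsum K k a W *+ 2 =
     k%:Z ^+ 2 * al + k%:Z * (ua - ub) - k%:Z * W%:Z + k%:Z * (intcols K a W)%:Z) /\
  (forall t : int * int, K t.1%:~R t.2%:~R ->
     (t.1 - a) * (ua + t.2) + (a + W%:Z - t.1) * (t.2 + ub) <= al).
Proof.
have [al [E B]] := floorsum_hull gK (st_ua st) (st_ub st) strip_lt.
have WE : absz (a + W%:Z - a)%R = W by lia.
move: E B; rewrite /= WE => E B; exists al; split.
  by move=> k /E ->; have -> : a + W%:Z - a = W%:Z by lia.
move=> t Kt; apply: B => //; have := st_in st Kt; by rewrite !ler_int.
Qed.

End InStrip.
End Pick.

(** * Pick's and Scott's theorems *)

Section Scott.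
Variable R : realType.
Implicit Types (K : R -> R -> Prop) (S : seq (int * int)).

(** For infinite [A] the image is infinite too, and both sides are 0 by the default value of
    [fset_set]. *)
Lemma card_fset_inj (T U : choiceType) (f : T -> U) (A : set T) : injective f ->
  #|` fset_set (f @` A)| = #|` fset_set A|.
Proof.
move=> fI; have [fA|iA] := pselect (finite_set A).
  by rewrite fset_set_image // card_imfset.
rewrite /fset_set; case: pselect => [fA|_]; last by case: pselect.
suff /iA : finite_set A by [].
apply: (@sub_finite_set _ _ (f @^-1` (f @` A))); first by move=> x Ax; exists x.
by apply: finite_preimage => // x y _ _ /fI.
Qed.

Lemma npoints_lin (a b c d : int) (D : set (int * int)) : (a * d - b * c) ^+ 2 = 1 ->
  npoints [set z : int * int | D (a * z.1 + b * z.2, c * z.1 + d * z.2)] = npoints D.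
Proof.
move=> det1; pose f (z : int * int) := (a * z.1 + b * z.2, c * z.1 + d * z.2).
have e2 (z : int) : z = (a * d - b * c) * (a * d - b * c) * z by rewrite -expr2 det1 mul1r.
have fK : cancel f (adj_pt a b c d).
  by move=> [x y]; congr pair; rewrite /f /= [RHS]e2; ring.
have gK : cancel (adj_pt a b c d) f.
  by move=> [x y]; congr pair; rewrite /f /= [RHS]e2; ring.
rewrite /npoints -[in RHS](_ : f @` [set z | D (f z)] = D).
  by rewrite card_fset_inj //; apply: can_inj fK.
apply/seteqP; split=> [_ [z Dz <-] //|z Dz]; exists (adj_pt a b c d z); last exact: gK.
by rewrite /= gK.
Qed.

Lemma lattice_count_lin K (a b c d : int) k : (a * d - b * c) ^+ 2 = 1 ->
  lattice_count (lin K a b c d) k = lattice_count K k.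
Proof.
move=> det1; rewrite /lattice_count -[RHS](npoints_lin _ det1); congr npoints; apply/seteqP.
have E z1 z2 : lin K a b c d (z1%:~R / k%:R) (z2%:~R / k%:R) =
    K ((a * z1 + b * z2)%:~R / k%:R) ((c * z1 + d * z2)%:~R / k%:R).
  by rewrite /lin !(intrD, intrM); congr (K _ _); ring.
by split=> z /=; rewrite E.
Qed.

Lemma core_lin K (a b c d : int) x y : (a * d - b * c) ^+ 2 = 1 ->
  core (lin K a b c d) x y <->
  core K (a%:~R * x + b%:~R * y) (c%:~R * x + d%:~R * y).
Proof.
move=> det1; pose e : R := (a * d - b * c)%:~R.
have eE : e = a%:~R * d%:~R - b%:~R * c%:~R by rewrite /e !(intrB, intrM).
have e2 (z : R) : z = e * e * z by rewrite -intrM -expr2 det1 mul1r.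
split=> H dx dy.
  have [t [t0 Kt]] := H (e * (d%:~R * dx - b%:~R * dy)) (e * (a%:~R * dy - c%:~R * dx)).
  exists t; split=> //; move: Kt; rewrite /lin; congr (K _ _).
    by rewrite [in RHS](e2 dx) eE; ring.
  by rewrite [in RHS](e2 dy) eE; ring.
have [t [t0 Kt]] := H (a%:~R * dx + b%:~R * dy) (c%:~R * dx + d%:~R * dy).
by exists t; split=> //; move: Kt; rewrite /lin; congr (K _ _); ring.
Qed.

Lemma core_count_lin K (a b c d : int) : (a * d - b * c) ^+ 2 = 1 ->
  core_count (lin K a b c d) = core_count K.
Proof.
move=> det1; rewrite /core_count -[RHS](npoints_lin _ det1); congr npoints; apply/seteqP.
by split=> z /=; rewrite !(intrD, intrM) => H; apply/(core_lin _ _ _ det1).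
Qed.

Lemma flipK K : flip (flip K) = K.
Proof. by apply/funext => x; apply/funext => y; rewrite /flip opprK. Qed.

Lemma strip_flip K a W ua ub va vb :
  strip K a W ua ub va vb -> strip (flip K) a W va vb ua ub.
Proof. by case=> *; split; rewrite ?flipK // => x y; rewrite /flip; eauto. Qed.

Section StripArea.
Variables (K : R -> R -> Prop) (S : seq (int * int)).
Hypothesis gK : gen_convex K S.
Variables (a : int) (W : nat) (ua ub va vb : int).
Hypothesis st : strip K a W ua ub va vb.

(* al is twice the area, split into its parts above and below the x-axis. *)
Lemma strip_pick : exists al au av : int, [/\ al = au + av,
  forall k, (0 < k)%N ->
    (lattice_count K k)%:Z *+ 2 = k%:Z ^+ 2 * al + k%:Z * (bd_count K)%:Z + 2,
  forall t : int * int, K t.1%:~R t.2%:~R ->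
     (t.1 - a) * (ua + t.2) + (a + W%:Z - t.1) * (t.2 + ub) <= au &
  forall t : int * int, K t.1%:~R t.2%:~R ->
     (t.1 - a) * (va - t.2) + (a + W%:Z - t.1) * (- t.2 + vb) <= av].
Proof.
have [S' gK'] := gen_flip gK; have st' := strip_flip st.
have [au [Eu Bu]] := floorsum_strip gK st.
have [av [Ev Bv]] := floorsum_strip gK' st'.
have [_ bE] := bd_countE gK st.
exists (au + av), au, av; split=> // [k k0|t Kt].
  (* The terms [- k W] of the two floor sums cancel against the number of columns; what remains
     linear in [k] is the boundary count. *)
  rewrite (lattice_countE gK st k0) bE 4!mulrnDl Eu // Ev // PoszM; ring.
by have := Bv (t.1, - t.2); rewrite /flip /= intrN opprK => /(_ Kt).
Qed.

Lemma intcols_le (F : R -> R -> Prop) : (intcols F a W <= W)%N.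
Proof.
rewrite -[leqRHS]card_ord -sum1_card; apply: leq_sum => i _.
by case: (_ \is a _).
Qed.

(** With at most two boundary points, both vertical sides would be points and the upper and lower
    boundaries single segments with the same ends, so [K] would lie on a line. *)
Lemma strip_bd_ge3 : (3 <= bd_count K)%N.
Proof.
have [S' gK'] := gen_flip gK; have st' := strip_flip st.
have [_ bE] := bd_countE gK st; have [q0 q1] := side_ge0 gK st.
have ab := strip_lt st.
have WE : absz (a + W%:Z - a)%R = W by lia.
have := intcols_hull gK (st_ua st) (st_ub st) ab; rewrite /= WE.
have := intcols_hull gK' (st_va st) (st_vb st) ab; rewrite /= WE.
have := intcols_recl st; have := intcols_recl_flip st => gv1 gu1.
move=> [gv2|Kv]; first by lia.
move=> [gu2|Ku]; first by lia.
rewrite leqNgt; apply/negP => b2.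
have E1 : va = - ua by lia.
have E2 : vb = - ub by lia.
have W0 : 0 < (W%:Z)%:~R :> R by rewrite ltr0z ltz_nat (st_W st).
have [_ /eqP] : - (ub - ua)%:~R = 0 :> R /\ (W%:Z)%:~R = 0 :> R; last by rewrite gt_eqF.
apply: (gc_plane gK (c := ua%:~R * (W%:Z)%:~R - (ub - ua)%:~R * a%:~R)) => x y Kxy.
have := Ku x y Kxy; have := Kv x (- y); rewrite {1}/flip opprK => /(_ Kxy).
rewrite E1 E2 !(intrD, intrN) /= => H1 H2; lra.
Qed.

End StripArea.

(** * Scott's inequality and its exceptional triangle *)

Definition tri3 (x y : R) := [/\ 0 <= x, 0 <= y & x + y <= 3].

Definition equiv_tri3 K := exists a b c d e f : int, (a * d - b * c) ^+ 2 = 1 /\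
  forall x y, K x y <->
    tri3 (a%:~R * x + b%:~R * y + e%:~R) (c%:~R * x + d%:~R * y + f%:~R).

(** The 9 boundary points force equality in [b <= Q + 2 W] with [Q = W = 3], so both boundaries have
    integral heights over all integral abscissas. The single interior point and concavity then
    determine the shape. *)
Lemma strip3_tri K S a ua ub va vb : gen_convex K S -> strip K a 3 ua ub va vb ->
  core_count K = 1%N -> bd_count K = 9%N -> ua + va + (ub + vb) <= 3 -> equiv_tri3 K.
Proof.
move=> gK st i1 b9 Q3.
have [S' gK'] := gen_flip gK; have st' := strip_flip st.
have [_ bE] := bd_countE gK st; have [q0 q1] := side_ge0 gK st.
have gu3 : intcols K a 3 = 3%N.
  by have := intcols_le a 3 K; have := intcols_le a 3 (flip K); lia.
have gv3 : intcols (flip K) a 3 = 3%N.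
  by have := intcols_le a 3 K; have := intcols_le a 3 (flip K); lia.
have Q : ua + va + (ub + vb) = 3 by lia.
have ints (F : R -> R -> Prop) : intcols F a 3 = 3%N ->
    exists z1 z2 : int, upper F (a + 1)%:~R = z1%:~R /\ upper F (a + 2)%:~R = z2%:~R.
  rewrite /intcols !big_ord_recl big_ord0 /= /bump /= !add1n => H.
  have : upper F (a + 1)%:~R \is a Num.int /\ upper F (a + 2)%:~R \is a Num.int.
    by move: H; do 3![case: (_ \is a _)].
  by move=> [/intrP[z1 ->] /intrP[z2 ->]]; exists z1, z2.
have [u1 [u2 [u1E u2E]]] := ints _ gu3; have [v1 [v2 [v1E v2E]]] := ints _ gv3.
have in1 : a%:~R <= ((a + 1)%:~R : R) <= (a + 3)%:~R by rewrite !ler_int; lia.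
have in2 : a%:~R <= ((a + 2)%:~R : R) <= (a + 3)%:~R by rewrite !ler_int; lia.
have tu1 := top_u gK st in1; have tu2 := top_u gK st in2.
have tv1 := top_v gK st in1; have tv2 := top_v gK st in2.
rewrite u1E in tu1; rewrite u2E in tu2; rewrite v1E in tv1; rewrite v2E in tv2.
have sum3 : u1 + v1 + (u2 + v2) = 3.
  have := core_countE gK st; rewrite i1 big_ltn // big_ltn // big_geq //.
  by rewrite /core_column u1E u2E v1E v2E !intrKfloor !intr_int; lia.
have chord (F : R -> R -> Prop) T (x1 x2 x3 y1 y2 y3 : int) : gen_convex F T ->
    F x1%:~R y1%:~R -> top F x2%:~R y2%:~R -> F x3%:~R y3%:~R -> x1 < x2 < x3 ->
    (y3 - y1) * (x2 - x1) <= (y2 - y1) * (x3 - x1).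
  move=> gF F1 F2 F3 /andP[x12 x23].
  have x13 : x1%:~R < x3%:~R :> R by rewrite ltr_int (lt_trans x12).
  have := top_chord gF F1 F3 x13 (x := x2%:~R).
  by rewrite !ler_int (ltW x12) (ltW x23) => /(_ _ isT F2); rewrite -!intrB -!intrM ler_int.
have cu1 := chord _ _ _ _ _ _ _ _ gK (st_ua st).1 tu1 tu2.1.
have cu2 := chord _ _ _ _ _ _ _ _ gK tu1.1 tu2 (st_ub st).1.
have cv1 := chord _ _ _ _ _ _ _ _ gK' (st_va st).1 tv1 tv2.1.
have cv2 := chord _ _ _ _ _ _ _ _ gK' tv1.1 tv2 (st_vb st).1.
have {}cu1 := cu1 ltac:(rewrite /=; lia); have {}cu2 := cu2 ltac:(rewrite /=; lia).
have {}cv1 := cv1 ltac:(rewrite /=; lia); have {}cv2 := cv2 ltac:(rewrite /=; lia).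
rewrite /= in cu1 cu2 cv1 cv2.
set sg := u1 - ua; set ta := v1 - va.
(* The lengths of the four columns are concave, and both the outer two and the inner two add up to
   3. Hence concavity holds with equality, and the upper and lower heights are arithmetic
   progressions. *)
have [u2s ubs] : u2 = ua + 2 * sg /\ ub = ua + 3 * sg by rewrite /sg; lia.
have [v2s vbs] : v2 = va + 2 * ta /\ vb = va + 3 * ta by rewrite /ta; lia.
have u1s : u1 = ua + sg by rewrite /sg; ring.
have v1s : v1 = va + ta by rewrite /ta; ring.
(* The column length changes by [sg + ta] per step; that the end lengths are nonnegative and sum to
   3 leaves only the lengths 3, 2, 1, 0 or their reversal. *)
have sgta : sg + ta = -1 /\ ua + va = 3 \/ sg + ta = 1 /\ ua + va = 0 by lia.
clearbody sg ta.
have KP x y : K x y <-> a%:~R <= x <= a%:~R + 3 /\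
    - va%:~R - ta%:~R * (x - a%:~R) <= y <= ua%:~R + sg%:~R * (x - a%:~R).
  have a3 : (a + 3)%:~R = a%:~R + 3 :> R by rewrite intrD.
  have aa3 : a%:~R < a%:~R + 3 :> R by rewrite ltrDl.
  split=> [Kxy|[xin /andP[ly uy]]].
    split; first by have := st_in st Kxy; rewrite a3.
    have lin (F : R -> R -> Prop) T (w0 s : int) : gen_convex F T ->
        top F a%:~R w0%:~R -> top F (a + 1)%:~R (w0 + s)%:~R ->
        top F (a + 2)%:~R (w0 + 2 * s)%:~R -> top F (a + 3)%:~R (w0 + 3 * s)%:~R ->
        (forall x y, F x y -> a%:~R <= x <= (a + 3)%:~R) ->
        forall x y, F x y -> - s%:~R * x + 1 * y <= w0%:~R - s%:~R * a%:~R.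
      move=> gF t0 t1 t2 t3 Fin x' y' ; apply: (gc_ineq gF) => -[s1 s2] /(gc_gen gF) /= Fs.
      have := Fin _ _ Fs; rewrite !ler_int => s1in.
      suff : s2 - s * s1 <= w0 - s * a.
        rewrite -(ler_int R) !(intrB, intrM).
        move: (s%:~R : R) (s1%:~R : R) (s2%:~R : R) (a%:~R : R) (w0%:~R : R) => *.
        by lra.
      (* Generators have integral abscissas, so four columns cover all cases. *)
      have : s1 = a \/ s1 = a + 1 \/ s1 = a + 2 \/ s1 = a + 3 by lia.
      case=> [E|[E|[E|E]]]; move: Fs; rewrite E.
      - by move=> /t0.2; rewrite ler_int; lia.
      - by move=> /t1.2; rewrite ler_int; lia.
      - by move=> /t2.2; rewrite ler_int; lia.
      - by move=> /t3.2; rewrite ler_int; lia.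
    have tu3 := st_ub st; have tv3 := st_vb st.
    rewrite u1s in tu1; rewrite u2s in tu2; rewrite ubs in tu3.
    rewrite v1s in tv1; rewrite v2s in tv2; rewrite vbs in tv3.
    have H1 := lin _ _ _ _ gK (st_ua st) tu1 tu2 tu3 (st_in st) _ _ Kxy.
    have Kxy' : flip K x (- y) by rewrite /flip opprK.
    have H2 := lin _ _ _ _ gK' (st_va st) tv1 tv2 tv3 (st_in st') _ _ Kxy'.
    move: H1 H2; move: (a%:~R : R) (ua%:~R : R) (va%:~R : R) (sg%:~R : R) (ta%:~R : R).
    by move=> *; apply/andP; split; lra.
  have K0 : K a%:~R ua%:~R := (st_ua st).1.
  have K3 : K (a + 3)%:~R ub%:~R := (st_ub st).1.
  have L0 : K a%:~R (- va%:~R) := (st_va st).1.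
  have L3 : K (a + 3)%:~R (- vb%:~R) := (st_vb st).1.
  rewrite a3 in K3 L3.
  have := convex_chord gK K0 K3 aa3 xin; have := convex_chord gK L0 L3 aa3 xin.
  have d3 : a%:~R + 3 - a%:~R = 3 :> R by ring.
  have ubR : ub%:~R = ua%:~R + 3 * sg%:~R :> R by rewrite ubs intrD intrM.
  have vbR : vb%:~R = va%:~R + 3 * ta%:~R :> R by rewrite vbs intrD intrM.
  rewrite d3 ubR vbR => H1 H2.
  have {}H1 : K x (- va%:~R - ta%:~R * (x - a%:~R)).
    by move: H1; congr (K _ _); field.
  have {}H2 : K x (ua%:~R + sg%:~R * (x - a%:~R)) by move: H2; congr (K _ _); field.
  by apply: (convex_vert gK H1 H2); rewrite ly uy.
(* A shear by [ta] makes the lower boundary horizontal; if the longer vertical side is on the right,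
   the abscissa is reversed as well. *)
have [r|r] := sgta.
- exists 1, 0, ta, 1, (- a), (va - ta * a); split=> [|x y]; first by ring.
  have sE : sg%:~R = -1 - ta%:~R :> R by rewrite -[-1]/((-1)%:~R) -intrB; congr _%:~R; lia.
  have uE : ua%:~R = 3 - va%:~R :> R by rewrite -[3%:R]/(3%:~R) -intrB; congr _%:~R; lia.
  apply: (iff_trans (KP x y)); rewrite /tri3 !(intrB, intrM, intrN) sE uE.
  split=> [[/andP[? ?] /andP[? ?]]|[? ? ?]]; first by split; lra.
  by split; apply/andP; split; lra.
- exists (-1), 0, ta, 1, (a + 3), (va - ta * a); split=> [|x y]; first by ring.
  have sE : sg%:~R = 1 - ta%:~R :> R by rewrite -[1]/(1%:~R) -intrB; congr _%:~R; lia.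
  have uE : ua%:~R = - va%:~R :> R by rewrite -intrN; congr _%:~R; lia.
  apply: (iff_trans (KP x y)); rewrite /tri3 !(intrD, intrB, intrM, intrN) sE uE.
  split=> [[/andP[? ?] /andP[? ?]]|[? ? ?]]; first by split; lra.
  by split; apply/andP; split; lra.
Qed.

(** A point [(X, Y)] of [K] becomes [(Y + s X, X)]: a vertical shear followed by the exchange of the
    coordinates. *)
Lemma swap_shear_ex K S (s : int) : gen_convex K S ->
  exists S', gen_convex (lin K 0 1 1 (- s)) S'.
Proof.
move=> gK; exists (map (adj_pt 0 1 1 (- s)) S).
by apply: gen_convex_lin => //; rewrite mul0r sub0r mulr1 sqrrN expr1n.
Qed.

Lemma equiv_tri3_swap_shear K (s : int) : equiv_tri3 (lin K 0 1 1 (- s)) -> equiv_tri3 K.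
Proof.
move=> [a [b [c [d [e [f [det1 KP]]]]]]].
exists (a * s + b), a, (c * s + d), c, e, f; split.
  by rewrite -det1; ring.
move=> x y; have := KP (y + s%:~R * x) x; rewrite /lin => H.
apply: (iff_trans _ (iff_trans H _)).
  have -> : K (0%:~R * (y + s%:~R * x) + 1%:~R * x) (1%:~R * (y + s%:~R * x) + (- s)%:~R * x) = K x y.
    by congr (K _ _); rewrite ?intrN; ring.
  by [].
by rewrite /tri3 !(intrD, intrM); split=> -[H1 H2 H3]; split; lra.
Qed.

(** Induction on the width [W]. Since [al = 2 i + b - 2], the claim [b <= 2 i + 6] reads
    [2 b <= al + 8]. *)
Lemma scott_ineq K S : gen_convex K S -> (0 < core_count K)%N ->
  (bd_count K <= 2 * core_count K + 6)%N \/
  [/\ core_count K = 1%N, bd_count K = 9%N & equiv_tri3 K].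
Proof.
move=> gK; have [a [W [ua [ub [va [vb st]]]]]] := strip_ex gK.
have [n] := ubnP W.
elim: n => // n IH in K S gK a W ua ub va vb st *; rewrite ltnS => Wn i0.
have [al [au [av [alE countE Bu Bv]]]] := strip_pick gK st.
have [tot bE] := bd_countE gK st; have [q0 q1] := side_ge0 gK st.
have gu := intcols_le a W K; have gv := intcols_le a W (flip K).
have al2 : al = 2 * (core_count K)%:Z + (bd_count K)%:Z - 2.
  by have := countE 1%N isT; rewrite tot; lia.
have W2 : (2 <= W)%N.
  rewrite ltnNge; apply/negP => W1.
  by have := core_countE gK st; rewrite big_geq //; lia.
have Q1 : W%:Z * (ua + va + (ub + vb)) <= al.
  have := Bu (a, ua) (st_ua st).1; have := Bv (a, - va).
  by rewrite /= intrN => /(_ (st_va st).1); rewrite alE; lia.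
set Q := ua + va + (ub + vb) in Q1 bE *.
have Q0 : 0 <= Q by rewrite /Q; lia.
(* By [b <= Q + 2 W] and [W Q <= al] the claim follows whenever [(Q - 4) (W - 2) >= 0]. *)
have [Q4|Q3] := lerP 4 Q.
  have : 0 <= (Q - 4) * (W%:Z - 2) by apply: mulr_ge0; lia.
  by left; lia.
have [W2'|W3] := leqP W 2; first by have E : W = 2%N by [lia]; rewrite E in Q1 gu gv bE; left; lia.
have [W3'|W4] := leqP W 3.
  have E : W = 3%N by lia.
  rewrite E in Q1 gu gv st bE.
  have [i1|i2] := eqVneq (core_count K) 1%N; last by left; lia.
  have [b9|b9] := eqVneq (bd_count K) 9%N; last by left; lia.
  by right; split=> //; apply: (strip3_tri gK st) => //; rewrite -/Q; lia.
(* The shear brings the gap between the two vertical sides down to (W - Q) / 2. *)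
pose c0 := - vb - ua.
pose s := ((W%:Z - Q - 2 * c0) %/ (2 * W)%N)%Z.
have [s1 s2] : 2 * (c0 + s * W%:Z) <= W%:Z - Q /\ W%:Z - Q < 2 * (c0 + s * W%:Z) + 2 * W%:Z.
  have W0 : ((2 * W)%N : int) != 0 by lia.
  have Em := divz_eq (W%:Z - Q - 2 * c0) (2 * W)%N.
  have r0 := modz_ge0 (W%:Z - Q - 2 * c0) W0.
  have r1 := @ltz_pmod (W%:Z - Q - 2 * c0) (2 * W)%N; rewrite ltz_nat in r1.
  have {}r1 := r1 ltac:(lia); rewrite -/s in Em; lia.
have [S' gK'] := swap_shear_ex s gK.
have det1 : (0 * - s - 1 * 1) ^+ 2 = 1 :> int by rewrite mul0r sub0r mulr1 sqrrN expr1n.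
have iE : core_count (lin K 0 1 1 (- s)) = core_count K by apply: core_count_lin.
have bE' : bd_count (lin K 0 1 1 (- s)) = bd_count K.
  by rewrite /bd_count lattice_count_lin // core_count_lin.
have [a' [W' [ua' [ub' [va' [vb' st']]]]]] := strip_ex gK'.
have [W'W|WW'] := ltnP W' W.
  have W'n : (W' < n)%N by lia.
  have := IH _ _ gK' _ _ _ _ _ _ st' W'n; rewrite iE bE' => /(_ i0)[H|[H1 H2 H3]]; first by left.
  by right; split=> //; apply: equiv_tri3_swap_shear H3.
(* The area is bounded below by means of the four corners of the vertical sides and the two points
   of [K] that are highest and lowest after the shear. *)
have HT := Bu (ub', a' + W'%:Z - s * ub'); have HB := Bv (ua', a' - s * ua').
have {}HT : (ub' - a) * (ua + (a' + W'%:Z - s * ub')) + (a + W%:Z - ub') * (a' + W'%:Z - s * ub' + ub) <= au.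
  apply: HT => /=; have := (st_ub st').1; rewrite /lin /=; congr (K _ _);
  by ring.
have {}HB : (ua' - a) * (va - (a' - s * ua')) + (a + W%:Z - ua') * (- (a' - s * ua') + vb) <= av.
  apply: HB => /=; have := (st_ua st').1; rewrite /lin /=; congr (K _ _);
  by ring.
have inT := st_in st (x := ub'%:~R); have inB := st_in st (x := ua'%:~R).
have {inT} tin : a <= ub' <= a + W%:Z.
  have := (st_ub st').1; rewrite /lin /= mul0r add0r mul1r => /inT.
  by rewrite !ler_int.
have {inB} rin : a <= ua' <= a + W%:Z.
  have := (st_ua st').1; rewrite /lin /= mul0r add0r mul1r => /inB.
  by rewrite !ler_int.
pose t := ub' - a; pose r := ua' - a.
pose E := - s * W%:Z * (t - r) + t * ua + (W%:Z - t) * ub + r * va + (W%:Z - r) * vb.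
have [t0 tW] : 0 <= t /\ 0 <= W%:Z - t by rewrite /t; lia.
have [r0 rW] : 0 <= r /\ 0 <= W%:Z - r by rewrite /r; lia.
have alE' : W%:Z * W'%:Z + E <= al by rewrite alE /E /t /r; lia.
(* [E] is affine in [(t, r)], so a bound at the four corners of the square of side [W] suffices; the
   choice of [s] keeps it there above [- (W - Q) W / 2]. *)
have WE : 0 <= W%:Z * (2 * E + (W%:Z - Q) * W%:Z).
  have -> : W%:Z * (2 * E + (W%:Z - Q) * W%:Z) =
      t * r * (2 * (ua + va) + (W%:Z - Q))
    + t * (W%:Z - r) * (2 * (ua - s * W%:Z + vb) + (W%:Z - Q))
    + (W%:Z - t) * r * (2 * (ub + va + s * W%:Z) + (W%:Z - Q))
    + (W%:Z - t) * (W%:Z - r) * (2 * (ub + vb) + (W%:Z - Q)).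
    by rewrite /E; ring.
  by rewrite !addr_ge0 // mulr_ge0 ?mulr_ge0 //; move: s1 s2; rewrite /c0 /Q; lia.
have {}WE : 0 <= 2 * E + (W%:Z - Q) * W%:Z by rewrite -(pmulr_rge0 _ (x := W%:Z)) //; lia.
(* With [W' >= W] this gives [2 al >= W (W + Q)], hence [2 al + 16 - 4 (Q + 2 W) >= (W - 4) (W - 4 +
   Q)]. *)
have WW : 0 <= W%:Z * (W'%:Z - W%:Z) by apply: mulr_ge0; lia.
have WQ : 0 <= (W%:Z - 4) * Q by apply: mulr_ge0; lia.
have WW4 : 0 <= (W%:Z - 4) * (W%:Z - 4) by apply: mulr_ge0; lia.
left; lia.
Qed.

End Scott.

(** * Polytopes as subsets of the plane *)

Section Bridge.
Variable R : realType.
Implicit Types (P : set 'cV[R]_2) (s : seq 'cV[R]_2).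

Definition pt (x y : R) : 'cV[R]_2 := \col_i (if i == 0 then x else y).

Definition coords P : R -> R -> Prop := fun x y => P (pt x y).

Lemma ptE1 x y : pt x y 0 0 = x. Proof. by rewrite mxE. Qed.
Lemma ptE2 x y : pt x y 1 0 = y. Proof. by rewrite mxE. Qed.

Lemma ord2 (i : 'I_2) : i = 0 \/ i = 1.
Proof.
by case: i => [[|[|//]] ip]; [left|right]; apply/val_inj.
Qed.

Lemma pt_eta (z : 'cV[R]_2) : pt (z 0 0) (z 1 0) = z.
Proof.
by apply/matrixP => i j; rewrite mxE ord1; case: (ord2 i) => ->.
Qed.

Lemma pt_lin (c d x y x' y' : R) :
  c *: pt x y + d *: pt x' y' = pt (c * x + d * x') (c * y + d * y').
Proof. by apply/matrixP => i j; rewrite !mxE; case: ifP. Qed.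

(** Collecting the coefficients of repeated points makes the weights a function on [s], so that
    combinations can be mixed pointwise. *)
Lemma convex_hull_seq s x : uniq s -> convex_hull [set` s] x <->
  exists w : 'cV[R]_2 -> R, [/\ forall z, 0 <= w z, \sum_(z <- s) w z = 1 &
    x = \sum_(z <- s) w z *: z].
Proof.
move=> us; split=> [[n [v [w [vs w0 w1 ->]]]]|[w [w0 w1 ->]]].
  have filt i : [seq z <- s | v i == z] = [:: v i].
    rewrite -(@filter_pred1_uniq _ s (v i)) //; last exact: vs.
    by apply: eq_filter => z /=; rewrite eq_sym.
  exists (fun z => \sum_(i < n | v i == z) w i); split.
  - by move=> z; apply: sumr_ge0.
  - rewrite -w1 (exchange_big_dep xpredT) //=; apply: eq_bigr => i _.
    by rewrite -big_filter filt big_seq1.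
  - under [RHS]eq_bigr => z _ do rewrite scaler_suml.
    rewrite (exchange_big_dep xpredT) //=; apply: eq_bigr => i _.
    by rewrite -big_filter filt big_seq1.
exists (size s), (fun i => nth 0 s i), (fun i => w (nth 0 s i)); split.
- by move=> i; apply: mem_nth.
- by [].
- by rewrite -w1 [RHS](big_nth 0) big_mkord.
- by rewrite [LHS](big_nth 0) big_mkord.
Qed.

Lemma hull_seq_convex s x y (t : R) : uniq s -> convex_hull [set` s] x ->
  convex_hull [set` s] y -> 0 <= t <= 1 ->
  convex_hull [set` s] (t *: x + (1 - t) *: y).
Proof.
move=> us /(convex_hull_seq _ us)[w [w0 w1 ->]] /(convex_hull_seq _ us)[w' [w'0 w'1 ->]].
move=> /andP[t0 t1]; apply/(convex_hull_seq _ us).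
exists (fun z => t * w z + (1 - t) * w' z); split.
- by move=> z; rewrite addr_ge0 ?mulr_ge0 ?subr_ge0.
- by rewrite big_split -!mulr_sumr /= w1 w'1; ring.
- rewrite !scaler_sumr -big_split /=; apply: eq_bigr => z _.
  by rewrite [RHS]scalerDl !scalerA.
Qed.

(** A point [v] that is not extreme lies strictly between two others of the hull. In the resulting
    combination [v] has a coefficient below 1, so it can be solved for in terms of the remaining
    points. *)
Lemma hull_redundant s v : uniq s -> v \in s ->
  ~ vertices (convex_hull [set` s]) v ->
  convex_hull [set` s] = convex_hull [set` rem v s].
Proof.
move=> us vs nv; have urs := rem_uniq v us.
have srem : perm_eq s (v :: rem v s) by apply: perm_to_rem.
have Ks : convex_hull [set` s] v.
  apply/(convex_hull_seq _ us); exists (fun z => (z == v)%:R); split.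
  - by move=> z; case: eqP.
  - rewrite (bigD1_seq v) //= eqxx big1 ?addr0 // => z /negPf->//.
  - by rewrite (bigD1_seq v) //= eqxx scale1r big1 ?addr0 // => z /negPf->; rewrite scale0r.
have [y [z [t [Ky Kz t01 vE yz]]]] : exists y z (t : R), [/\ convex_hull [set` s] y,
    convex_hull [set` s] z, 0 < t < 1, v = t *: y + (1 - t) *: z & y <> z].
  apply: contrapT => H; apply: nv; split=> // y z t Ky Kz t01 vE.
  by apply: contrapT => yz; apply: H; exists y, z, t.
move: Ky Kz => /(convex_hull_seq _ us)[a [a0 a1 aE]] /(convex_hull_seq _ us)[b [b0 b1 bE]].
case/andP: t01 => t0 t1; have t1' : 0 < 1 - t by rewrite subr_gt0.
have t0w := ltW t0; have t1w := ltW t1'.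
pose c z := t * a z + (1 - t) * b z.
have c0 z' : 0 <= c z' by rewrite addr_ge0 ?mulr_ge0.
have c1 : \sum_(z <- s) c z = 1 by rewrite big_split -!mulr_sumr /= a1 b1; ring.
have cE : v = \sum_(z <- s) c z *: z.
  rewrite vE aE bE !scaler_sumr -big_split /=; apply: eq_bigr => z' _.
  by rewrite [RHS]scalerDl !scalerA.
rewrite (perm_big _ srem) big_cons /= in c1; rewrite (perm_big _ srem) big_cons /= in cE.
have cv1 : c v < 1.
  (* If the coefficient of [v] were 1, the combinations for [y] and [z] would have no weight off
     [v], and [y = z = v]. *)
  rewrite lt_neqAle -c1 lerDl sumr_ge0 ?andbT //; apply/negP => /eqP/esym c0'.
  have rem0 : \sum_(z <- rem v s) c z = 0.
    by apply: (addrI (c v)); rewrite addr0.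
  have cz z' : z' \in rem v s -> c z' = 0.
    by move=> zs; apply/eqP; move/eqP: rem0; rewrite psumr_eq0 // => /allP/(_ _ zs).
  have abz z' : z' \in rem v s -> a z' = 0 /\ b z' = 0.
    move=> /cz /eqP; rewrite paddr_eq0 ?mulr_ge0 // !mulf_eq0.
    by rewrite (gt_eqF t0) (gt_eqF t1') /= => /andP[/eqP-> /eqP->].
  have fin (w : 'cV[R]_2 -> R) : (forall z', z' \in rem v s -> w z' = 0) ->
      \sum_(z <- s) w z = 1 -> \sum_(z <- s) w z *: z = v.
    move=> w0; rewrite !(perm_big _ srem) !big_cons /= big_seq big1 => [|z' /w0->//].
    rewrite addr0 => ->; rewrite scale1r big_seq big1 ?addr0 // => z' /w0->.
    by rewrite scale0r.
  by apply: yz; rewrite aE bE !fin // => z' /abz[].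
have d0 : 0 < 1 - c v by rewrite subr_gt0.
have vE' : v = \sum_(z <- rem v s) (c z / (1 - c v)) *: z.
  have : (1 - c v) *: v = \sum_(z <- rem v s) c z *: z.
    by rewrite scalerBl scale1r {1}cE addrAC subrr add0r.
  move=> /(congr1 (fun z => (1 - c v)^-1 *: z)).
  rewrite scalerA mulVf ?lt0r_neq0 // scale1r => E.
  by rewrite [LHS]E scaler_sumr; apply: eq_bigr => z' _; rewrite scalerA mulrC.
have sumd : \sum_(z <- rem v s) c z = 1 - c v by rewrite -c1; ring.
apply/seteqP; split=> x; last first.
  move=> [n [f [w [fs w0 w1 xE]]]]; exists n, f, w; split=> // i.
  exact: mem_rem (fs i).
move=> /(convex_hull_seq _ us)[w [w0 w1 xE]]; apply/(convex_hull_seq _ urs).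
rewrite (perm_big _ srem) big_cons /= in w1; rewrite (perm_big _ srem) big_cons /= in xE.
exists (fun z => w z + w v * (c z / (1 - c v))); split.
- by move=> z'; rewrite addr_ge0 ?mulr_ge0 // invr_ge0 ltW.
- rewrite big_split -mulr_sumr -mulr_suml /= sumd divff ?lt0r_neq0 // mulr1.
  by rewrite addrC.
- have := congr1 (fun z => w v *: z) vE'; rewrite scaler_sumr => E.
  rewrite xE E -big_split /=; apply: eq_bigr => z' _.
  by rewrite [RHS]scalerDl scalerA addrC.
Qed.

Lemma hull_vertices s : uniq s -> exists s',
  [/\ uniq s', convex_hull [set` s] = convex_hull [set` s'] &
      forall v, v \in s' -> vertices (convex_hull [set` s']) v].
Proof.
have [n] := ubnP (size s); elim: n s => // n IH s sn us.
have [all_v|] := pselect (forall v, v \in s -> vertices (convex_hull [set` s]) v).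
  by exists s.
move=> /existsNP[v /not_implyP[vs nv]].
rewrite (hull_redundant us vs nv); apply: IH; last exact: rem_uniq.
by rewrite size_rem //; case: (s) vs sn.
Qed.

Lemma hull_ineq (A : set 'cV[R]_2) (a b c : R) :
  (forall z, A z -> a * z 0 0 + b * z 1 0 <= c) ->
  forall x y, coords (convex_hull A) x y -> a * x + b * y <= c.
Proof.
move=> H x y [n [v [w [Av w0 w1 /matrixP E]]]].
have Ex := E 0 0; have Ey := E 1 0; move: Ex Ey; rewrite ptE1 ptE2 !summxE => -> ->.
rewrite -[c]mul1r -w1 mulr_suml !mulr_sumr -big_split; apply: ler_sum => i _ /=.
rewrite !mxE mulrCA [b * _]mulrCA -mulrDr; apply: ler_wpM2l => //; exact: H.
Qed.

Lemma plane_zero P (a b c : R) : two_dimensional P ->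
  (forall x y, coords P x y -> a * x + b * y = c) -> a = 0 /\ b = 0.
Proof.
move=> P2 H; have {}H x y : a * x + b * y = c.
  have : affine_hull P (pt x y) by rewrite P2.
  move=> [n [v [w [Pv w1 /matrixP E]]]].
  have Ex := E 0 0; have Ey := E 1 0; move: Ex Ey; rewrite ptE1 ptE2 !summxE => -> ->.
  rewrite -[c]mul1r -w1 mulr_suml !mulr_sumr -big_split; apply: eq_bigr => i _ /=.
  rewrite !mxE mulrCA [b * _]mulrCA -mulrDr; congr (_ * _); apply: H.
  by rewrite /coords pt_eta.
have H1 := H 0 0; have H2 := H 1 0; have H3 := H 0 1.
by split; lra.
Qed.

(** Only the vertices are known to be lattice points, so the points spanning the polytope are first
    reduced to its vertices. *)
Lemma polygon_gen P : lattice_polygon P -> exists S, gen_convex (coords P) S.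
Proof.
move=> [[V Vf PE] P2 Pl].
have [sV sVE] := finite_fsetP.1 Vf.
have [s [us EV Vs]] := hull_vertices (fset_uniq sV).
have {}PE : P = convex_hull [set` s] by rewrite PE sVE EV.
rewrite -PE in Vs.
pose fz (z : 'cV[R]_2) : int * int := (Num.floor (z 0 0), Num.floor (z 1 0)).
have sE z : z \in s -> pt (fz z).1%:~R (fz z).2%:~R = z.
  by move=> /Vs/Pl zl; rewrite /fz /= !floorK // pt_eta.
exists (map fz s); split.
- move=> x y x' y' t Kx Ky t01; rewrite /coords -pt_lin PE.
  by apply: hull_seq_convex => //; rewrite -PE.
- by move=> _ /mapP[z zs ->]; rewrite /coords sE //; case: (Vs _ zs).
- move=> a b c H; rewrite PE; apply: hull_ineq => z /= zs.
  by have := H _ (map_f fz zs); rewrite -{3 4}(sE z zs) ptE1 ptE2.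
- by move=> a b c; apply: plane_zero.
Qed.

Lemma interior_core P S z : gen_convex (coords P) S ->
  interior P z <-> core (coords P) (z 0 0) (z 1 0).
Proof.
move=> gP; split.
  move=> /nbhs_ballP[d /= d0 dP] dx dy.
  have n0 : 0 < `|dx| + `|dy| + 1 by rewrite ltr_wpDl ?addr_ge0.
  set e := d / (`|dx| + `|dy| + 1); have e0 : 0 < e by apply: divr_gt0.
  exists e; split=> //; apply: dP; split=> // i j; rewrite ord1 mxE -ball_normE /=.
  have small (r : R) : `|r| <= `|dx| + `|dy| -> `|e * r| < d.
    move=> rs; rewrite normrM (gtr0_norm e0) /e mulrAC ltr_pdivrMr // ltr_pM2l //.
    by apply: le_lt_trans rs _; rewrite ltrDl.
  case: (ord2 i) => ->.
    by rewrite opprD addrA subrr add0r normrN small // lerDl.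
  by rewrite opprD addrA subrr add0r normrN small // lerDr.
set x := z 0 0; set y := z 1 0 => cP.
have [e1 [p1 K1]] := cP 1 0; have [e2 [p2 K2]] := cP (-1) 0.
have [e3 [p3 K3]] := cP 0 1; have [e4 [p4 K4]] := cP 0 (-1).
rewrite mulr1 mulr0 addr0 in K1; rewrite mulrN1 mulr0 addr0 in K2.
rewrite mulr1 mulr0 addr0 in K3; rewrite mulrN1 mulr0 addr0 in K4.
set d := Num.min (Num.min e1 e2) (Num.min e3 e4).
have [d1 [d2 [d3 d4]]] : [/\ d <= e1, d <= e2, d <= e3 & d <= e4] by
  rewrite /d !ge_min !lexx !orbT.
have d0 : 0 < d by rewrite /d !lt_min p1 p2 p3 p4.
(* The ball of radius [d / 2] in the maximum norm fits into the cross polytope of radius [d]. *)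
apply/nbhs_ballP; exists (d / 2) => /=; first exact: divr_gt0.
move=> z' zz'; have H1 := zz'.2 0 0; have H2 := zz'.2 1 0.
rewrite -ball_normE /= distrC in H1; rewrite -ball_normE /= distrC in H2.
have -> : z' = pt (x + (z' 0 0 - x)) (y + (z' 1 0 - y)).
  by rewrite -[LHS]pt_eta; congr pt; ring.
apply: (convex_cross gP (d := d)).
- by apply: (convex_horiz gP K2 K1); lra.
- by apply: (convex_horiz gP K2 K1); lra.
- by apply: (convex_vert gP K4 K3); lra.
- by apply: (convex_vert gP K4 K3); lra.
- by rewrite (splitr d) ltrD.
Qed.

(** A point outside has an open half-plane around it that misses [P]. *)
Lemma closure_gen P S : gen_convex (coords P) S -> closure P = P.
Proof.
move=> gP; apply/seteqP; split=> [z|]; last exact: subset_closure.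
move=> clz; apply: contrapT; rewrite -[z]pt_eta => nP.
have [a [W [ua [ub [va [vb st]]]]]] := strip_ex gP.
have [al [be [c [H zc]]]] := strip_separate gP st nP.
pose f (z : 'cV[R]_2) := al * z 0 0 + be * z 1 0.
have fc : {for z, continuous f}.
  by apply: (@continuousD R R^o); (apply: (@continuousM R);
    [exact: cst_continuous|exact: coord_continuous]).
have nz : nbhs z [set z' | c < f z'] by exact: (@cvgr_gt R _ (nbhs z) _ f (f z) fc c zc).
have [z' [Pz' /=]] := clz _ nz.
rewrite ltNge => /negP; apply; apply: H; by rewrite /coords pt_eta.
Qed.

End Bridge.

(** * Lattice point counts, the Ehrhart polynomial and lattice hulls *)

Section Polygons.
Variable R : realType.
Implicit Types (P : set 'cV[R]_2).

Definition ptz (z : int * int) : 'cV[R]_2 := pt z.1%:~R z.2%:~R.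

Lemma ptz_inj : injective ptz.
Proof.
move=> [x y] [x' y'] /matrixP E; have := E 0 0; have := E 1 0.
by rewrite !ptE1 !ptE2 /= => /intr_inj-> /intr_inj->.
Qed.

Lemma lattice_ptz z : lattice (ptz z).
Proof. by move=> i; case: (ord2 i) => ->; rewrite ?ptE1 ?ptE2 intr_int. Qed.

Lemma card_latticeE P : card_lattice P = npoints [set z | P (ptz z)].
Proof.
rewrite /card_lattice /npoints -(card_fset_inj _ ptz_inj); congr (#|` fset_set _ |).
apply/seteqP; split=> [x [Px xl]|_ [z Pz <-]]; last by split=> //; apply: lattice_ptz.
have E : ptz (Num.floor (x 0 0), Num.floor (x 1 0)) = x.
  by rewrite /ptz /= !floorK // pt_eta.
by exists (Num.floor (x 0 0), Num.floor (x 1 0)) => //; rewrite /= E.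
Qed.

Lemma card_dilate P k : (0 < k)%N ->
  card_lattice (dilate k P) = lattice_count (coords P) k.
Proof.
move=> k0; have kR : k%:R != 0 :> R by rewrite pnatr_eq0 -lt0n.
rewrite card_latticeE; congr npoints; apply/seteqP; split=> [[x y]|[x y] Pxy] /=.
  move=> [z Pz /matrixP E]; rewrite /coords.
  have := E 0 0; have := E 1 0; rewrite !mxE /= => <- <-.
  by rewrite ![k%:R * _]mulrC !mulfK // pt_eta.
exists (pt (x%:~R / k%:R) (y%:~R / k%:R)) => //; apply/matrixP => i j.
by rewrite !mxE /=; case: ifP => _; rewrite mulrC divfK.
Qed.

Section Gen.
Variables (P : set 'cV[R]_2) (S : seq (int * int)).
Hypothesis gP : gen_convex (coords P) S.

Lemma interior_ptz z : interior P (ptz z) <-> core (coords P) z.1%:~R z.2%:~R.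
Proof. by have := interior_core (ptz z) gP; rewrite ptE1 ptE2. Qed.

Lemma card_intE : card_int P = core_count (coords P).
Proof.
rewrite /card_int card_latticeE; congr npoints.
by apply/seteqP; split=> z /interior_ptz.
Qed.

Lemma card_bdE : card_bd P = bd_count (coords P).
Proof.
have [a [W [ua [ub [va [vb st]]]]]] := strip_ex gP.
have [tot _] := bd_countE gP st; have b3 := strip_bd_ge3 gP st.
have KE z : coords P (z.1%:~R / 1%:R) (z.2%:~R / 1%:R) = P (ptz z) by rewrite !divr1.
rewrite /card_bd card_latticeE (closure_gen gP) /bd_count /lattice_count /core_count.
set D1 := [set z | coords P _ _]; set D2 := [set z | core _ _ _].
have D1E z : D1 z = P (ptz z) by exact: KE.
have -> : [set z | (P `\` interior P) (ptz z)] = D1 `\` D2.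
  apply/seteqP; split=> z [Pz nI]; split.
  - by rewrite D1E.
  - by move=> /interior_ptz.
  - by rewrite -D1E.
  - by move=> /interior_ptz.
(* An infinite set would be counted as 0, against the at least three boundary points. *)
have D1f : finite_set D1.
  apply: contrapT => inf; suff : npoints D1 = 0%N by move: tot; rewrite /lattice_count -/D1; lia.
  by rewrite /npoints /fset_set; case: pselect.
have D21 : D2 `<=` D1.
  by move=> z /interior_ptz /interior_subset; rewrite D1E.
have D2f : finite_set D2 := sub_finite_set D21 D1f.
rewrite /npoints fset_setD // cardfsD; congr (_ - _)%N.
by rewrite -fset_setI // (setIidr D21).
Qed.

End Gen.

Definition ehrhart_poly (i b : nat) : {poly R[i]} :=
  ((((2 * i + b)%:R - 2) / 2)%:P * 'X^2 + (b%:R / 2)%:P * 'X + 1%:P).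

Lemma is_ehrhart_uniq P p q : is_ehrhart P p -> is_ehrhart P q -> p = q.
Proof.
move=> Ep Eq; apply/eqP; rewrite -subr_eq0; apply/negPn/negP => pq0.
pose rs := [seq (k.+1)%:R : R[i] | k <- iota 0 (size (p - q))].
suff : (size rs < size (p - q)%R)%N by rewrite size_map size_iota ltnn.
apply: max_poly_roots => //.
  apply/allP => _ /mapP[k _ ->]; rewrite rootE !hornerE.
  by rewrite Ep // Eq // subrr.
rewrite map_inj_uniq ?iota_uniq // => m n /eqP.
by rewrite eqr_nat eqSS => /eqP.
Qed.

(** Collects what the study of the zeros uses about an arbitrary lattice polygon. *)
Lemma polygon_summary P : lattice_polygon P ->
  [/\ (3 <= card_bd P)%N,
    [\/ card_int P = 0%N, (card_bd P <= 2 * card_int P + 6)%N |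
      [/\ card_int P = 1%N, card_bd P = 9%N & equiv_tri3 (coords P)]] &
    forall s, ehrhart_zeros P s <->
      ((2 * card_int P + card_bd P)%:R - 2) * s ^+ 2 + (card_bd P)%:R * s + 2 = 0].
Proof.
move=> /polygon_gen[S gP]; rewrite (card_intE gP) (card_bdE gP).
set i := core_count _; set b := bd_count _.
have [a [W [ua [ub [va [vb st]]]]]] := strip_ex gP.
have [tot _] := bd_countE gP st; have b3 := strip_bd_ge3 gP st.
split=> //.
  have [->|i0] := posnP i; first by constructor 1.
  by have [?|?] := scott_ineq gP i0; [constructor 2|constructor 3].
have [al [_ [_ [_ cE _ _]]]] := strip_pick gP st.
(* Pick's theorem, read off at [k = 1]. *)
have alE : al = 2 * i%:Z + b%:Z - 2.
  by have := cE 1%N isT; rewrite tot -/i -/b; lia.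
have two : 2 != 0 :> R[i] by rewrite pnatr_eq0.
have isE : is_ehrhart P (ehrhart_poly i b).
  move=> k k0; rewrite /ehrhart_poly !hornerE card_dilate //.
  apply: (mulfI two).
  have E : 2 * (lattice_count (coords P) k)%:Z = k%:Z ^+ 2 * al + k%:Z * b%:Z + 2.
    by rewrite mulr_natl cE.
  have := congr1 (fun z : int => z%:~R : R[i]) E; rewrite /= alE expr2 intrM => ->.
  by rewrite !(intrD, intrM, intrN) (natrD _ _ b) natrM; field.
have EE : ehrhart P = ehrhart_poly i b.
  apply: (is_ehrhart_uniq _ isE).
  exact: (@xgetI _ 0 [set p | is_ehrhart P p] _ isE).
move=> s; have E : 2 * (ehrhart_poly i b).[s] =
    ((2 * i + b)%:R - 2) * s ^+ 2 + b%:R * s + 2.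
  by rewrite /ehrhart_poly !(hornerD, hornerM, hornerC, hornerXn, hornerX); field.
rewrite /ehrhart_zeros /= rootE EE -(inj_eq (mulfI two)) mulr0 E.
by split=> /eqP.
Qed.

(** [P] and [Q] are preimages of one triangle under [M x + e] and [N x + f]; the map from [P] to [Q]
    is the first followed by the inverse of the second. *)
Lemma equiv_tri3_unimodular P Q : equiv_tri3 (coords P) -> equiv_tri3 (coords Q) ->
  unimodularly_equivalent P Q.
Proof.
have toM F : equiv_tri3 (coords F) -> exists (M : 'M[int]_2) (t : 'cV[int]_2),
    M \in unitmx /\ forall x, F x <->
      (fun y : 'cV[R]_2 => tri3 (y 0 0) (y 1 0)) (map_mx intr M *m x + map_mx intr t).
  move=> [a [b [c [d [e [f [det1 FP]]]]]]].
  exists (\matrix_(i, j) if i == 0 then if j == 0 then a else b else if j == 0 then c else d).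
  exists (\col_i if i == 0 then e else f); split.
    rewrite unitmxE (expand_det_row _ 0) !big_ord_recl big_ord0 /cofactor !det_mx11 !mxE /=.
    rewrite (_ : _ + _ = a * d - b * c); last by rewrite /bump /=; ring.
    by apply/unitrP; exists (a * d - b * c); rewrite -expr2.
  move=> x; rewrite -{1}[x]pt_eta; apply: (iff_trans (FP _ _)).
  rewrite !mxE !big_ord_recl !big_ord0 !mxE /= !addr0.
  by rewrite (_ : lift ord0 ord0 = 1) //; apply/val_inj.
move=> /toM[M [e [uM PM]]] /toM[N [f [uN QN]]].
have uU : invmx N *m M \in unitmx by rewrite unitmx_mul unitmx_inv uN.
exists (invmx N *m M), (invmx N *m (e - f)); split=> //.
have NK : map_mx intr N *m map_mx intr (invmx N) = 1%:M :> 'M[R]_2.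
  by rewrite -map_mxM mulmxV // map_mx1.
have key x : map_mx intr N *m (map_mx intr (invmx N *m M) *m x +
    map_mx intr (invmx N *m (e - f))) + map_mx intr f =
    map_mx intr M *m x + map_mx intr e :> 'cV[R]_2.
  rewrite !map_mxM mulmxDr !mulmxA NK !mul1mx map_mxB -addrA subrK //.
apply/seteqP; split=> [y /QN Qy|_ [x /PM Px <-]]; last by apply/QN; rewrite key.
pose U : 'M[R]_2 := map_mx intr (invmx N *m M).
have UK : U *m map_mx intr (invmx (invmx N *m M)) = 1%:M.
  by rewrite -map_mxM mulmxV // map_mx1.
pose x := map_mx intr (invmx (invmx N *m M)) *m (y - map_mx intr (invmx N *m (e - f))).
have xE : U *m x + map_mx intr (invmx N *m (e - f)) = y.
  by rewrite /x mulmxA UK mul1mx subrK.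
by exists x => //; apply/PM; rewrite -key -/U xE.
Qed.

Definition lattice_hull (V : seq (int * int)) : set 'cV[R]_2 :=
  convex_hull [set` [seq ptz v | v <- V]].

Lemma lattice_hull_mem V v : v \in V -> coords (lattice_hull V) v.1%:~R v.2%:~R.
Proof.
move=> vV; exists 1%N, (fun=> ptz v), (fun=> 1); split.
- by move=> _; apply/mapP; exists v.
- by [].
- by rewrite big_ord1.
- by rewrite big_ord1 scale1r.
Qed.

Lemma lattice_hull_ineq V (a b c : R) :
  (forall v, v \in V -> a * v.1%:~R + b * v.2%:~R <= c) ->
  forall x y, coords (lattice_hull V) x y -> a * x + b * y <= c.
Proof.
move=> H; apply: hull_ineq => _ /mapP[v /H vc ->].
by rewrite ptE1 ptE2.
Qed.

(** Take a point of positive weight in a combination for [x]. Either its weight is 1, or [x] lies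
    strictly between it and the normalized rest; by extremality it equals [x] in both cases. *)
Lemma vertices_hull (A : set 'cV[R]_2) : vertices (convex_hull A) `<=` A.
Proof.
move=> x [[n [v [w [Av w0 w1 xE]]]] ext].
have [i wi] : exists i, 0 < w i.
  apply: contrapT => /forallNP H; have : (0 : R) < 1 by [].
  rewrite -w1 big1 ?ltxx // => i _; apply/eqP; rewrite eq_le w0 andbT leNgt.
  by apply/negP; apply: H.
have Hv j : convex_hull A (v j).
  exists 1%N, (fun=> v j), (fun=> 1); split=> //; first by rewrite big_ord1.
  by rewrite big_ord1 scale1r.
move: (w1) xE; rewrite (bigD1 i) //= => w1' xE.
rewrite (bigD1 i) //= in xE.
have [wi1|wi1] := eqVneq (w i) 1.
  have H0 : \sum_(j < n | j != i) w j = 0.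
    by apply: (addrI (w i)); rewrite w1' wi1 addr0.
  rewrite big1 in xE => [|j ji].
    by rewrite xE wi1 scale1r addr0.
  have := psumr_eq0P (fun j _ => w0 j) H0 ji => ->; exact: scale0r.
have wi_lt : w i < 1.
  by rewrite lt_neqAle wi1 -w1' lerDl sumr_ge0.
have d0 : 1 - w i != 0 by rewrite subr_eq0 eq_sym.
have S1 : \sum_(j < n | j != i) w j = 1 - w i.
  by apply: (addrI (w i)); rewrite w1'; ring.
pose y := \sum_(j < n | j != i) (w j / (1 - w i)) *: v j.
have Hy : convex_hull A y.
  exists n, v, (fun j => if j == i then 0 else w j / (1 - w i)); split=> //.
  - by move=> j; case: ifP => // _; rewrite divr_ge0 // subr_ge0 ltW.
  - rewrite (bigD1 i) //= eqxx add0r (eq_bigr (fun j => w j / (1 - w i))).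
      by rewrite -mulr_suml S1 divff.
    by move=> j /negPf->.
  - rewrite [RHS](bigD1 i) //= eqxx scale0r add0r; apply: eq_bigr => j /negPf->//.
have xE' : x = w i *: v i + (1 - w i) *: y.
  rewrite xE /y scaler_sumr; congr (_ + _); apply: eq_bigr => j _.
  by rewrite scalerA mulrC divfK.
have vy := ext _ _ _ (Hv i) Hy _ xE'; rewrite wi wi_lt in vy.
have {}vy := vy isT.
have -> : x = v i by rewrite xE' -vy -scalerDl addrC subrK scale1r.
exact: Av.
Qed.

Lemma lattice_hull_polygon V p q r : p \in V -> q \in V -> r \in V ->
  (q.1 - p.1) * (r.2 - p.2) != (q.2 - p.2) * (r.1 - p.1) ->
  lattice_polygon (lattice_hull V).
Proof.
move=> pV qV rV det0; split.
- by exists [set` [seq ptz v | v <- V]] => //; apply: finite_seq.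
- apply/seteqP; split=> // z _.
  have ex3 (a b c : R) (A B C : 'cV[R]_2) : exists f : 'I_3 -> R, exists g : 'I_3 -> 'cV[R]_2,
     [/\ \sum_i f i = a + b + c, \sum_i f i *: g i = a *: A + b *: B + c *: C &
        forall i, g i = A \/ g i = B \/ g i = C].
    exists (fun i : 'I_3 => nth 0 [:: a; b; c] i), (fun i : 'I_3 => nth 0 [:: A; B; C] i).
    rewrite !big_ord_recl !big_ord0 /= !addr0 !addrA; split=> //.
    by move=> [[|[|[|//]]] ip] /=; [left|right; left|right; right].
  pose D : R := ((q.1 - p.1) * (r.2 - p.2) - (q.2 - p.2) * (r.1 - p.1))%:~R.
  have D0 : D != 0 by rewrite intr_eq0 subr_eq0.
  pose x := z 0 0; pose y := z 1 0.
  (* Barycentric coordinates with respect to [p], [q], [r], by Cramer's rule. *)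
  pose be : R := ((x - p.1%:~R) * (r.2%:~R - p.2%:~R) - (y - p.2%:~R) * (r.1%:~R - p.1%:~R)) / D.
  pose ga : R := ((q.1%:~R - p.1%:~R) * (y - p.2%:~R) - (q.2%:~R - p.2%:~R) * (x - p.1%:~R)) / D.
  have [f [g [f1 fE gE]]] := ex3 (1 - be - ga) be ga (ptz p) (ptz q) (ptz r).
  exists 3%N, g, f; split.
  + move=> i; case: (gE i) => [->|[->|->]]; exact: lattice_hull_mem.
  + by rewrite f1; ring.
  + have DE : D = (q.1%:~R - p.1%:~R) * (r.2%:~R - p.2%:~R) - (q.2%:~R - p.2%:~R) * (r.1%:~R - p.1%:~R).
      by rewrite /D !(intrB, intrM).
    rewrite fE -[z]pt_eta /ptz pt_lin -[X in _ = X + _]scale1r pt_lin.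
    by congr pt; rewrite -/x -/y /be /ga; field: DE; rewrite -DE.
- apply: subset_trans (@vertices_hull _) _ => _ /mapP[v _ ->]; exact: lattice_ptz.
Qed.

End Polygons.

Arguments lattice_hull R V : clear implicits.

(** * Examples *)

Section Examples.
Variable R : realType.

(** The certificate is a supporting line through the point, which has to be tested at the generators
    only. *)
Lemma topz_hull V (x y al be c : int) : coords (lattice_hull R V) x%:~R y%:~R ->
  0 < be -> (forall v, v \in V -> al * v.1 + be * v.2 <= c) -> al * x + be * y = c ->
  topz (coords (lattice_hull R V)) (x, y).
Proof.
move=> Kxy be0 H E; split=> // z Kz.
have : al%:~R * x%:~R + be%:~R * z <= c%:~R.
  by apply: lattice_hull_ineq Kz => v /H; rewrite -(ler_int R) intrD !intrM.
by rewrite -E intrD !intrM lerD2l ler_pM2l ?ltr0z.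
Qed.

Lemma topz_flip_hull V (x y al be c : int) : coords (lattice_hull R V) x%:~R (- y%:~R) ->
  0 < be -> (forall v, v \in V -> al * v.1 - be * v.2 <= c) -> al * x + be * y = c ->
  topz (flip (coords (lattice_hull R V))) (x, y).
Proof.
move=> Kxy be0 H E; split=> // z Kz.
have : al%:~R * x%:~R + - be%:~R * (- z) <= c%:~R.
  apply: lattice_hull_ineq Kz => v /H.
  by rewrite -(ler_int R) intrD intrN !intrM mulNr.
by rewrite -E intrD !intrM mulrNN lerD2l ler_pM2l ?ltr0z.
Qed.

Lemma lattice_hull_cols V (a b : int) : (forall v, v \in V -> a <= v.1 <= b) ->
  forall x y, coords (lattice_hull R V) x y -> a%:~R <= x <= b%:~R.
Proof.
move=> H x y Kxy; apply/andP; split.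
  have := @lattice_hull_ineq R V (-1) 0 (- a%:~R) _ _ _ Kxy.
  rewrite mul0r addr0 mulN1r lerN2; apply=> v /H/andP[+ _].
  by rewrite mul0r addr0 mulN1r lerN2 ler_int.
have := @lattice_hull_ineq R V 1 0 b%:~R _ _ _ Kxy.
rewrite mul0r addr0 mul1r; apply=> v /H/andP[_].
by rewrite mul0r addr0 mul1r ler_int.
Qed.

Lemma strip_counts (P : set 'cV[R]_2) a W ua ub va vb : lattice_polygon P ->
  strip (coords P) a W ua ub va vb ->
  (card_int P)%:Z = \sum_(1 <= i < W) core_column (coords P) a i /\
  (card_bd P)%:Z = ua + va + (ub + vb) + (intcols (coords P) a W)%:Z
    + (intcols (flip (coords P)) a W)%:Z :> int.
Proof.
move=> /polygon_gen[S gP] st; rewrite (card_intE gP) (card_bdE gP).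
by split; [exact: (core_countE gP st)|case: (bd_countE gP st)].
Qed.

(** A triangle of width 1: no column is interior, the vertical side has [l + 1] lattice points and
    the apex adds one. *)
Lemma ex_triangle (l : nat) : (0 < l)%N -> exists P : set 'cV[R]_2,
  [/\ lattice_polygon P, card_int P = 0%N & card_bd P = (l + 2)%N].
Proof.
move=> l0; pose V : seq (int * int) := [:: (0, 0); (0, l%:Z); (1, 0)].
have VP (Q : int * int -> Prop) : Q (0, 0) -> Q (0, l%:Z) -> Q (1, 0) ->
    forall v, v \in V -> Q v.
  by move=> ? ? ? v; rewrite !inE => /or3P[] /eqP->.
have mV v : v \in V -> coords (lattice_hull R V) v.1%:~R v.2%:~R by apply: lattice_hull_mem.
have lP : lattice_polygon (lattice_hull R V).
  by apply: (@lattice_hull_polygon R V (0, 0) (0, l%:Z) (1, 0));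
    rewrite ?inE ?eqxx ?orbT //=; lia.
have st : strip (coords (lattice_hull R V)) 0 1 l%:Z 0 0 0.
  split=> //.
  - by apply: lattice_hull_cols; apply: VP.
  - apply: (topz_hull (al := l%:Z) (be := 1) (c := l%:Z)) => //.
    + by apply: (mV (0, l%:Z)); rewrite !inE eqxx orbT.
    + by apply: VP => /=; lia.
    + by ring.
  - apply: (topz_hull (al := l%:Z) (be := 1) (c := l%:Z)) => //.
    + by apply: (mV (1, 0)); rewrite !inE eqxx !orbT.
    + by apply: VP => /=; lia.
    + by ring.
  - apply: (topz_flip_hull (al := 0) (be := 1) (c := 0)) => //.
    + by rewrite oppr0; apply: (mV (0, 0)); rewrite !inE eqxx.
    + by apply: VP => /=; lia.
  - apply: (topz_flip_hull (al := 0) (be := 1) (c := 0)) => //.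
    + by rewrite oppr0; apply: (mV (1, 0)); rewrite !inE eqxx !orbT.
    + by apply: VP => /=; lia.
have [iE bE] := strip_counts lP st; exists (lattice_hull R V); split=> //.
  by move: iE; rewrite big_geq // => -[].
move: bE; rewrite /intcols !big_ord1 addr0.
by rewrite (upperE (st_ua st)) (upperE (st_va st)) /= !rpred_int; lia.
Qed.

(* The hull of (-1, 0), (0, 0), (0, w), (1, 0), (1, n): the condition on n puts (0, w)
   on the boundary, so that the interior points are (0, 1), ..., (0, w - 1). *)
Lemma ex_quadrilateral (n w : nat) : (0 < w)%N -> (n <= 2 * w)%N ->
  exists P : set 'cV[R]_2,
  [/\ lattice_polygon P, card_int P = w.-1 & card_bd P = (n + 4)%N].
Proof.
move=> w0 nw; pose V : seq (int * int) := [:: (-1, 0); (0, 0); (0, w%:Z); (1, 0); (1, n%:Z)].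
have VP (Q : int * int -> Prop) : Q (-1, 0) -> Q (0, 0) -> Q (0, w%:Z) -> Q (1, 0) ->
    Q (1, n%:Z) -> forall v, v \in V -> Q v.
  by move=> ? ? ? ? ? v; rewrite !inE => /or4P[|||/orP[]] /eqP->.
have mV v : v \in V -> coords (lattice_hull R V) v.1%:~R v.2%:~R by apply: lattice_hull_mem.
have lP : lattice_polygon (lattice_hull R V).
  by apply: (@lattice_hull_polygon R V (0, 0) (0, w%:Z) (1, 0));
    rewrite ?inE ?eqxx ?orbT //=; lia.
have vtop (x : int) : (x, 0) \in V -> topz (flip (coords (lattice_hull R V))) (x, 0).
  move=> xV; apply: (topz_flip_hull (al := 0) (be := 1) (c := 0)) => //.
  - by rewrite oppr0; apply: (mV (x, 0)).
  - by apply: VP => /=; lia.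
  - by ring.
have st : strip (coords (lattice_hull R V)) (-1) 2 0 n%:Z 0 0.
  split=> //.
  - by apply: lattice_hull_cols; apply: VP.
  - apply: (topz_hull (al := - w%:Z) (be := 1) (c := w%:Z)) => //.
    + by apply: (mV (-1, 0)); rewrite !inE eqxx.
    + by apply: VP => /=; lia.
    + by ring.
  - apply: (topz_hull (al := w%:Z - n%:Z) (be := 1) (c := w%:Z)) => //.
    + by apply: (mV (1, n%:Z)); rewrite !inE eqxx !orbT.
    + by apply: VP => /=; lia.
    + by ring.
  - by apply: (vtop (-1)); rewrite !inE eqxx.
  - by apply: (vtop 1); rewrite !inE eqxx !orbT.
have tu : topz (coords (lattice_hull R V)) (0, w%:Z).
  apply: (topz_hull (al := - w%:Z) (be := 1) (c := w%:Z)) => //.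
  + by apply: (mV (0, w%:Z)); rewrite !inE eqxx !orbT.
  + by apply: VP => /=; lia.
  + by ring.
have tv : topz (flip (coords (lattice_hull R V))) (0, 0).
  by apply: (vtop 0); rewrite !inE eqxx !orbT.
have [iE bE] := strip_counts lP st; exists (lattice_hull R V); split=> //.
  move: iE; rewrite big_nat1 /core_column (_ : -1 + 1%:Z = 0) //.
  by rewrite (upperE tu) (upperE tv) /= !intrKfloor !intr_int; lia.
move: bE; rewrite /intcols !big_ord_recl !big_ord0 /= /bump /= (_ : -1 + (1 + 0)%N%:Z = 0) //.
rewrite !addr0 (upperE (st_ua st)) (upperE (st_va st)) (upperE tu) (upperE tv) /=.
by rewrite !intr_int; lia.
Qed.

Lemma ex_tri3 : exists P : set 'cV[R]_2,
  [/\ lattice_polygon P, card_int P = 1%N & card_bd P = 9%N].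
Proof.
pose V : seq (int * int) := [:: (0, 0); (0, 3); (3, 0)].
have VP (Q : int * int -> Prop) : Q (0, 0) -> Q (0, 3) -> Q (3, 0) ->
    forall v, v \in V -> Q v.
  by move=> ? ? ? v; rewrite !inE => /or3P[] /eqP->.
have mV v : v \in V -> coords (lattice_hull R V) v.1%:~R v.2%:~R by apply: lattice_hull_mem.
have lP : lattice_polygon (lattice_hull R V).
  by apply: (@lattice_hull_polygon R V (0, 0) (0, 3) (3, 0)); rewrite ?inE ?eqxx ?orbT.
have [S gP] := polygon_gen lP.
have K00 : coords (lattice_hull R V) 0 0 by apply: (mV (0, 0)); rewrite !inE eqxx.
have K03 : coords (lattice_hull R V) 0 3%:~R by apply: (mV (0, 3)); rewrite !inE eqxx orbT.
have K30 : coords (lattice_hull R V) 3%:~R 0 by apply: (mV (3, 0)); rewrite !inE eqxx !orbT.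
have tu (x : int) : 0 <= x <= 3 -> topz (coords (lattice_hull R V)) (x, 3 - x).
  move=> /andP[x0 x3]; apply: (topz_hull (al := 1) (be := 1) (c := 3)) => //.
  - apply: (convexE gP (t := x%:~R / 3) K30 K03).
    + by rewrite divr_ge0 ?ler0z //= ler_pdivrMr // mul1r -[3]/(3%:~R) ler_int.
    + by field.
    + by rewrite intrB; field.
  - by apply: VP.
  - by ring.
have tv (x : int) : 0 <= x <= 3 -> topz (flip (coords (lattice_hull R V))) (x, 0).
  move=> /andP[x0 x3]; apply: (topz_flip_hull (al := 0) (be := 1) (c := 0)) => //.
  - rewrite oppr0; apply: (convex_horiz gP K00 K30).
    by rewrite ler0z x0 ler_int.
  - by apply: VP.
  - by ring.
have st : strip (coords (lattice_hull R V)) 0 3 3 0 0 0.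
  split=> //.
  - by apply: lattice_hull_cols; apply: VP.
  - exact: (tu 0).
  - exact: (tu 3).
  - exact: (tv 0).
  - exact: (tv 3).
have [iE bE] := strip_counts lP st; exists (lattice_hull R V); split=> //.
  move: iE; rewrite big_ltn // big_nat1 /core_column !add0r.
  rewrite (upperE (tu 1 isT)) (upperE (tu 2 isT)) (upperE (tv 1 isT)) (upperE (tv 2 isT)) /=.
  by rewrite !intrKfloor !intr_int => -[].
move: bE; rewrite /intcols !big_ord_recl !big_ord0 /= /bump /= !add0r.
rewrite (upperE (tu 0 isT)) (upperE (tu 1 isT)) (upperE (tu 2 isT)).
rewrite (upperE (tv 0 isT)) (upperE (tv 1 isT)) (upperE (tv 2 isT)) /=.
by rewrite !intr_int => -[].
Qed.

End Examples.

(** * Zeros of Ehrhart polynomials *)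

Section Zeros.
Variable R : realType.
Implicit Types (P : set 'cV[R]_2) (x y : R) (i b : nat).

(** The real and imaginary parts of twice the Ehrhart polynomial at the point with real part [x] and
    imaginary part [y]. *)
Definition quad_zero i b x y :=
  ((2 * i + b)%:R - 2) * (x ^+ 2 - y ^+ 2) + b%:R * x + 2 = 0 /\
  y * (2 * ((2 * i + b)%:R - 2) * x + b%:R) = 0.

Lemma ehrhart_zeroP P (s : R[i]) : lattice_polygon P ->
  ehrhart_zeros P s <-> quad_zero (card_int P) (card_bd P) (complex.Re s) (complex.Im s).
Proof.
move=> /polygon_summary[_ _ /(_ s) H]; apply: (iff_trans H).
case: s {H} => x y; rewrite /quad_zero /=.
set i := card_int P; set b := card_bd P.
have natC (n : nat) : n%:R = (n%:R)%:C%C :> R[i] by rewrite rmorph_nat.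
have -> : ((2 * i + b)%:R - 2) * (x +i* y)%C ^+ 2 + b%:R * (x +i* y)%C + 2 =
  ((((2 * i + b)%:R - 2) * (x ^+ 2 - y ^+ 2) + b%:R * x + 2)
   +i* (y * (2 * ((2 * i + b)%:R - 2) * x + b%:R)))%C.
  rewrite !natC expr2; apply/eqP; rewrite eq_complex /=.
  by apply/andP; split; apply/eqP; ring.
split=> [/eqP|[-> ->] //]; rewrite eq_complex /= => /andP[/eqP-> /eqP->] //.
Qed.

Lemma area_gt0 i b : (3 <= b)%N -> 1 <= (2 * i + b)%:R - 2 :> R.
Proof.
move=> b3; have : 3 <= (2 * i + b)%:R :> R by rewrite ler_nat; lia.
by lra.
Qed.

(** Vieta's formulas for a pair of conjugate zeros, and the negative discriminant. *)
Lemma quad_nonreal i b x y : (3 <= b)%N -> quad_zero i b x y -> y != 0 ->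
  [/\ 2 * ((2 * i + b)%:R - 2) * x = - b%:R,
      ((2 * i + b)%:R - 2) * (x ^+ 2 + y ^+ 2) = 2 &
      b%:R ^+ 2 < 8 * ((2 * i + b)%:R - 2) :> R].
Proof.
move=> /area_gt0-/(_ i); set A := _ - 2; set B : R := b%:R.
move=> A1 [E1 /eqP]; rewrite mulf_eq0 -/A -/B => /orP[->//|/eqP E2] y0.
rewrite -/A -/B in E1.
have E3 : 2 * A * x = - B by lra.
have y2 : 0 < y ^+ 2 by rewrite exprn_even_gt0.
have E4 : A * (x ^+ 2 + y ^+ 2) = 2.
  have : B * x = - (2 * A * x ^+ 2) by rewrite expr2 mulrA E3; ring.
  move=> E; rewrite E in E1; apply: subr0_eq.
  by rewrite -[RHS]oppr0 -E1; ring.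
split=> //.
have -> : B ^+ 2 = (2 * A * x) ^+ 2 by rewrite E3 sqrrN.
have A0 : 0 < A by lra.
have : 0 < A * A * y ^+ 2 by rewrite mulr_gt0 // mulr_gt0.
have -> : 8 * A = 4 * A * (A * (x ^+ 2 + y ^+ 2)) by rewrite E4; ring.
by move=> H; rewrite -subr_gt0; move: (mulr_gt0 (ltr0n _ 4) H); congr (0 < _); ring.
Qed.

(** For [i = 0] the polynomial factors as [((b - 2) s + 2) (s + 1)]. *)
Lemma quad_noint b x y : (3 <= b)%N -> quad_zero 0 b x y ->
  y = 0 /\ (x = -1 \/ x = - (2 / (b%:R - 2))).
Proof.
move=> b3 Z; have A1 := area_gt0 0 b3; rewrite /= muln0 add0n in A1.
have y0 : y = 0.
  apply/eqP/negPn/negP => y0; have [_ _] := quad_nonreal b3 Z y0.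
  rewrite muln0 add0n => H.
  have := sqr_ge0 (b%:R - 4 : R); rewrite !expr2 in H *; lra.
split=> //; move: Z; rewrite y0 /quad_zero muln0 add0n => -[E _].
have /eqP : ((b%:R - 2) * x + 2) * (x + 1) = 0 by rewrite -E; ring.
rewrite mulf_eq0 => /orP[/eqP H|/eqP H]; [right|left; lra].
apply: (mulfI (x := b%:R - 2)); first by rewrite gt_eqF //; lra.
by rewrite mulrN mulrCA divff ?mulr1; [lra|rewrite gt_eqF //; lra].
Qed.

(** The expansion about -1/2. Scott's inequality says that its constant term is nonnegative, and for
    [i = 1] the linear term vanishes. *)
Lemma quad_real i b x : quad_zero i b x 0 ->
  ((2 * i + b)%:R - 2) * (x + 2^-1) ^+ 2 + (2 - 2 * i%:R) * (x + 2^-1)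
    + (2 * i%:R + 6 - b%:R) / 4 = 0.
Proof.
move=> [+ _]; rewrite expr0n subr0 natrD natrM => E.
by rewrite -[RHS]E; field.
Qed.

Lemma quad_lt0 i b x y : (3 <= b)%N -> quad_zero i b x y -> x < 0.
Proof.
move=> b3 Z; have A1 := area_gt0 i b3.
have b0 : 0 < b%:R :> R by rewrite ltr0n; lia.
have [y0|y0] := eqVneq y 0; last first.
  have [E _ _] := quad_nonreal b3 Z y0.
  rewrite ltNge; apply/negP => x0.
  have : 0 <= 2 * ((2 * i + b)%:R - 2) * x by rewrite !mulr_ge0 //; lra.
  by rewrite E; lra.
case: Z => + _; rewrite y0 expr0n subr0 => E; rewrite ltNge; apply/negP => x0.
have : 0 <= ((2 * i + b)%:R - 2) * x ^+ 2 by rewrite mulr_ge0 ?sqr_ge0 //; lra.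
have : 0 <= b%:R * x by rewrite mulr_ge0 //; lra.
by lra.
Qed.

(** Left of -1/2 all terms of the expansion in [quad_real] are nonnegative and the first is
    positive. A nonreal zero has real part [- b / (2 (2 i + b - 2))], where [i > 0] gives the
    bound. *)
Lemma quad_ge i b x y : (3 <= b)%N -> (0 < i)%N -> (b <= 2 * i + 6)%N ->
  quad_zero i b x y -> - (1 / 2) <= x.
Proof.
move=> b3 i0 b6 Z; have A1 := area_gt0 i b3.
have i1 : 1 <= i%:R :> R by rewrite ler1n.
have b6R : b%:R <= 2 * i%:R + 6 :> R by rewrite -!(natrM, natrD) ler_nat.
have AE : (2 * i + b)%:R = 2 * i%:R + b%:R :> R by rewrite natrD natrM.
rewrite leNgt; apply/negP => xh; have xh' : 0 < - (x + 2^-1) by lra.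
have [y0|y0] := eqVneq y 0; last first.
  have [E _ _] := quad_nonreal b3 Z y0.
  have : 0 < 2 * ((2 * i + b)%:R - 2) * - (x + 2^-1) by rewrite !mulr_gt0 //; lra.
  rewrite mulrN mulrDr E AE; lra.
rewrite y0 in Z; have := quad_real Z.
have : 0 < ((2 * i + b)%:R - 2) * (x + 2^-1) ^+ 2.
  by rewrite mulr_gt0 ?exprn_even_gt0 //=; [lra|rewrite -oppr_eq0 gt_eqF].
have : 0 <= (2 * i%:R - 2) * - (x + 2^-1) by rewrite mulr_ge0 //; lra.
by lra.
Qed.

Lemma normc_le (z : R[i]) (r : R) : 0 <= r ->
  (`|z| <= r%:C%C) = (complex.Re z ^+ 2 + complex.Im z ^+ 2 <= r ^+ 2).
Proof.
move=> r0; rewrite normc_def lecR -{1}(ger0_norm r0) -sqrtr_sqr ler_sqrt ?sqr_ge0 //.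
Qed.

Lemma normc_eq (z : R[i]) (r : R) : 0 <= r ->
  complex.Re z ^+ 2 + complex.Im z ^+ 2 = r ^+ 2 -> `|z| = r%:C%C.
Proof. by move=> r0 E; rewrite normc_def E sqrtr_sqr ger0_norm. Qed.

Lemma complexD_real (s : R[i]) (r : R) :
  complex.Re (s + r%:C%C) = complex.Re s + r /\ complex.Im (s + r%:C%C) = complex.Im s.
Proof. by case: s => x y /=; rewrite addr0. Qed.

Lemma complex_nat (n : nat) : n%:R = (n%:R)%:C%C :> R[i].
Proof. by rewrite rmorph_nat. Qed.

Lemma complex_div (m n : nat) : m%:R / n%:R = (m%:R / n%:R)%:C%C :> R[i].
Proof. by rewrite fmorph_div !rmorph_nat. Qed.

Lemma complex_real_Im (s : R[i]) : s \is Num.real <-> complex.Im s = 0.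
Proof. by case: s => x y; rewrite complex_real; split=> /eqP. Qed.

(** With [A = 2 i + b - 2], Vieta gives [x ^+ 2 + y ^+ 2 = 2 / A] and [x = - b / (2 A)], so
    [x ^+ 2 + y ^+ 2 + 4 x / b = 0]. *)
Lemma nonreal_circle P (s : R[i]) : lattice_polygon P -> ehrhart_zeros P s ->
  s \isn't Num.real -> `|s + 2 / (card_bd P)%:R| = 2 / (card_bd P)%:R.
Proof.
move=> lP /(ehrhart_zeroP _ lP) Z sr; have [b3 _ _] := polygon_summary lP.
have y0 : complex.Im s != 0 by apply: contraNneq sr => /complex_real_Im.
have [E1 E2 _] := quad_nonreal b3 Z y0; have A1 := area_gt0 (card_int P) b3.
rewrite complex_div; set b : R := (card_bd P)%:R in E1 E2 A1 *.
set A := _ - 2 in E1 E2 A1.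
have b0 : 0 < b by rewrite ltr0n; lia.
apply: normc_eq; first by rewrite divr_ge0 // ltW.
have [-> ->] := complexD_real s (2 / b); move: (complex.Re s) (complex.Im s) E1 E2 => x y E1 E2.
have A0 : A != 0 by rewrite gt_eqF //; lra.
have bE : b = - (2 * A * x) by rewrite E1 opprK.
have x0 : x != 0 by apply/eqP => x0; move: b0; rewrite bE x0; lra.
have E3 : y ^+ 2 = 2 / A - x ^+ 2 by rewrite -E2; field.
by rewrite E3 bE; field; rewrite A0 x0.
Qed.

Lemma real_zeros_iff P : lattice_polygon P ->
  (forall s : R[i], ehrhart_zeros P s -> s \is Num.real) <->
  (card_int P)%:R <= ((card_bd P)%:R / 4 - 1) ^+ 2 :> R.
Proof.
move=> lP; have [b3 _ _] := polygon_summary lP.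
set i := card_int P; set b := card_bd P.
have A1 := area_gt0 i b3; have AE : (2 * i + b)%:R = 2 * i%:R + b%:R :> R by rewrite natrD natrM.
have disc : 16 * ((b%:R / 4 - 1) ^+ 2 - i%:R) = b%:R ^+ 2 - 8 * ((2 * i + b)%:R - 2) :> R.
  by rewrite AE; field.
split=> [allr|H s Zs]; last first.
  apply/complex_real_Im/eqP/negPn/negP => y0.
  have [_ _] := quad_nonreal b3 ((ehrhart_zeroP s lP).1 Zs) y0; rewrite -/i -/b; lra.
rewrite leNgt; apply/negP => H.
set A := (2 * i + b)%:R - 2 in A1 disc.
have d0 : 0 < 8 * A - b%:R ^+ 2 by lra.
(* A negative discriminant gives a nonreal zero by the quadratic formula. *)
pose y := Num.sqrt (8 * A - b%:R ^+ 2) / (2 * A).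
have y0 : 0 < y by rewrite divr_gt0 ?sqrtr_gt0 //; lra.
have A0 : A != 0 by rewrite gt_eqF //; lra.
suff /(ehrhart_zeroP (- b%:R / (2 * A) +i* y)%C lP)/allr/complex_real_Im /= y0' :
    quad_zero i b (- b%:R / (2 * A)) y.
  by rewrite y0' ltxx in y0.
split; rewrite -/A; last by field.
rewrite {1}/y expr_div_n (expr_div_n (Num.sqrt _)) sqr_sqrtr ?ltW //.
by field.
Qed.

(** The disc is [x ^+ 2 + y ^+ 2 + 4 x / 3 <= 0], which contains the circles for [b >= 3] and the
    real zeros in [-1/2, 0). The three isolated points come from [i = 0] with [b] at most 5; -2/3
    also occurs for [i = 1], [b = 9]. *)
Lemma gamma2_region : Gamma2 R `<=`
  [set -2; -1; - (2 / 3)] `|`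
  [set s : R[i] | - (1 / 2) <= complex.Re s < 0 /\ `|s + 2 / 3| <= 2 / 3].
Proof.
move=> s [P lP /(ehrhart_zeroP _ lP)]; have [b3 sc _] := polygon_summary lP.
move: (card_int P) (card_bd P) b3 sc => i b b3 sc Z.
have x0 := quad_lt0 b3 Z; have A1 := area_gt0 i b3.
have region : - (1 / 2) <= complex.Re s ->
    complex.Re s ^+ 2 + complex.Im s ^+ 2 + 4 / 3 * complex.Re s <= 0 ->
    ([set -2; -1; - (2 / 3)] `|`
     [set s : R[i] | - (1 / 2) <= complex.Re s < 0 /\ `|s + 2 / 3| <= 2 / 3]) s.
  move=> xh H; right; split; first by rewrite xh x0.
  rewrite complex_div normc_le ?divr_ge0 //; have [-> ->] := complexD_real s (2 / 3).
  by rewrite sqrrD expr_div_n; lra.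
have realreg : - (1 / 2) <= complex.Re s -> complex.Im s = 0 ->
    ([set -2; -1; - (2 / 3)] `|`
     [set s : R[i] | - (1 / 2) <= complex.Re s < 0 /\ `|s + 2 / 3| <= 2 / 3]) s.
  move=> xh y0; apply: region => //; rewrite y0 expr0n addr0 expr2 -mulrDl.
  by rewrite mulr_ge0_le0 //; lra.
have special (r : R) : complex.Re s = - r -> complex.Im s = 0 -> s = - r%:C%C.
  by case: (s) => x y /= -> ->; apply/eqP; rewrite eq_complex /= oppr0 !eqxx.
have nonreal : complex.Im s != 0 -> - (1 / 2) <= complex.Re s ->
    ([set -2; -1; - (2 / 3)] `|`
     [set s : R[i] | - (1 / 2) <= complex.Re s < 0 /\ `|s + 2 / 3| <= 2 / 3]) s.
  move=> y0 xh; have [E1 E2 _] := quad_nonreal b3 Z y0; apply: region => //.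
  have b3R : 3 <= b%:R :> R by rewrite ler_nat.
  have A0 : 0 < (2 * i + b)%:R - 2 :> R by lra.
  by rewrite -(pmulr_rle0 _ A0) mulrDr E2 mulrCA; lra.
have [y0|y0] := eqVneq (complex.Im s) 0; last first.
  apply: nonreal => //; case: sc => [i0|b6|[i1 b9 _]].
  - by move: Z; rewrite i0 => /(quad_noint b3)[/eqP]; rewrite (negPf y0).
  - have [i0|i0] := posnP i; last exact: quad_ge b6 Z.
    by move: Z; rewrite i0 => /(quad_noint b3)[/eqP]; rewrite (negPf y0).
  - have [_ _] := quad_nonreal b3 Z y0; rewrite i1 b9 /= expr2 -natrM; lra.
have noint : i = 0%N -> ([set -2; -1; - (2 / 3)] `|`
     [set s : R[i] | - (1 / 2) <= complex.Re s < 0 /\ `|s + 2 / 3| <= 2 / 3]) s.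
  move=> i0; move: Z; rewrite i0 => /(quad_noint b3)[_ [xE|xE]].
    by left; left; right; rewrite (special 1 xE y0).
  have [b6|b6] := leqP 6 b.
    apply: realreg => //; rewrite xE lerN2.
    have b6R : 6 <= b%:R :> R by rewrite ler_nat.
    by rewrite ler_pdivrMr; lra.
  have : b = 3%N \/ b = 4%N \/ b = 5%N by lia.
  move=> [bE|[bE|bE]]; rewrite bE in xE.
  - left; left; left; rewrite complex_nat; apply: special => //.
    by rewrite xE; field.
  - by left; left; right; apply: (special 1) => //; rewrite xE; field.
  - by left; right; rewrite /= complex_div; apply: special => //; rewrite xE; field.
case: sc => [//|b6|[i1 b9 _]].
  have [//|i0] := posnP i; apply: realreg => //; exact: quad_ge b6 Z.
have /eqP : (3 * complex.Re s + 1) * (3 * complex.Re s + 2) = 0.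
  by case: Z => E _; rewrite i1 b9 y0 /= expr0n subr0 in E; rewrite -[RHS]E; ring.
rewrite mulf_eq0 => /orP[/eqP xE|/eqP xE]; first by apply: realreg => //; lra.
by left; right; rewrite /= complex_div; apply: special => //; lra.
Qed.

(** The zeros are those of [quad_noint], with [l = b - 2]; [ex_triangle] realizes every [l]. *)
Lemma gamma20_eq : Gamma20 R =
  [set -1] `|` [set s : R[i] | exists2 l : int, 1 <= l & s = - (2 / l%:~R)].
Proof.
apply/seteqP; split=> s.
  move=> [P [lP i0 /(ehrhart_zeroP _ lP)]]; have [b3 _ _] := polygon_summary lP.
  rewrite i0 => /(quad_noint b3); case: s => x y /= [-> [->|->]].
    by left; apply/eqP; rewrite eq_complex /= oppr0 !eqxx.
  right; exists (card_bd P - 2)%N%:Z; first by lia.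
  have -> : ((card_bd P - 2)%N%:Z)%:~R = (card_bd P - 2)%:R :> R[i] by [].
  rewrite complex_div; apply/eqP; rewrite eq_complex /= oppr0 eqxx andbT.
  by rewrite natrB //; lia.
have ex (l : nat) x : (0 < l)%N -> x = -1 \/ x = - (2 / l%:R) -> Gamma20 R (x +i* 0)%C.
  move=> l0 xE; have [P [lP i0 bE]] := ex_triangle R l0; exists P; split=> //.
  apply/(ehrhart_zeroP _ lP); rewrite i0 bE /quad_zero /= muln0 add0n mul0r; split=> //.
  have lR : l%:R != 0 :> R by rewrite pnatr_eq0 -lt0n.
  by case: xE => ->; rewrite natrD; field.
move=> [/= ->|[l l1 ->]].
  have -> : -1 = (-1 +i* 0)%C :> R[i] by apply/eqP; rewrite eq_complex /= oppr0 !eqxx.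
  by apply: (ex 1%N) => //; left.
have -> : l%:~R = `|l|%N%:R :> R[i] by case: l l1.
rewrite complex_div (_ : - _ = (- (2 / `|l|%:R) +i* 0)%C).
  by apply: (ex `|l|%N); [lia|right].
by apply/eqP; rewrite eq_complex /= oppr0 !eqxx.
Qed.

(** For nonreal zeros, real part -1/2 means [2 i + b - 2 = b], that is [i = 1]. For [i = 1] a real
    zero satisfies [b (x + 1/2) ^+ 2 = (b - 8) / 4], so [b <= 8] forces [x = -1/2]. *)
Lemma gamma2_half : [set s | Gamma2 R s /\ complex.Re s = - (1 / 2)] =
  [set s | exists P : set 'cV[R]_2,
     [/\ lattice_polygon P, card_int P = 1%N, (card_bd P <= 8)%N & ehrhart_zeros P s]].
Proof.
apply/seteqP; split=> s /=; last first.
  move=> [P [lP i1 b8 Zs]]; split; first by exists P.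
  have [b3 _ _] := polygon_summary lP.
  move: Zs => /(ehrhart_zeroP _ lP); rewrite i1; move: (card_bd P) b3 b8 => b b3 b8 Z.
  have b8R : b%:R <= 8 :> R by rewrite ler_nat.
  have b3R : 3 <= b%:R :> R by rewrite ler_nat.
  have [y0|y0] := eqVneq (complex.Im s) 0; last first.
    have [E _ _] := quad_nonreal b3 Z y0; rewrite natrD in E.
    have b0 : b%:R != 0 :> R by rewrite pnatr_eq0; lia.
    by apply: (mulfI b0); lra.
  rewrite y0 in Z; have := quad_real Z; rewrite natrD /= mulr1 => E.
  have h0 : 0 <= b%:R * (complex.Re s + 2^-1) ^+ 2 by rewrite mulr_ge0 ?sqr_ge0.
  have /eqP : b%:R * (complex.Re s + 2^-1) ^+ 2 = 0 by lra.
  rewrite mulf_eq0 pnatr_eq0 sqrf_eq0 => /orP[/eqP b0|/eqP]; [lia|lra].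
move=> [[P lP Zs] xE]; have [b3 sc _] := polygon_summary lP.
have Z := (ehrhart_zeroP s lP).1 Zs; rewrite xE in Z.
have [y0|y0] := eqVneq (complex.Im s) 0; last first.
  have [E _ E2] := quad_nonreal b3 Z y0.
  have i1 : card_int P = 1%N.
    apply/eqP; rewrite -(eqr_nat R); apply/eqP.
    by move: E; rewrite natrD natrM; lra.
  exists P; split=> //; case: sc => [i0|b6|[_ b9 _]]; first by rewrite i0 in i1.
    by rewrite i1 in b6.
  by move: E2; rewrite i1 b9 /= expr2 -natrM; lra.
(* The zero -1/2 itself may come from another polygon; it is the double zero for [i = 1],
   [b = 8]. *)
have [P' [lP' i1 b8]] := @ex_quadrilateral R 4 2 isT isT.
exists P'; split; rewrite ?b8 //; apply/(ehrhart_zeroP _ lP').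
by rewrite xE y0 i1 b8 /quad_zero mul0r /=; split=> //; field.
Qed.

Lemma exceptional_zeros P : lattice_polygon P -> card_int P = 1%N -> (8 < card_bd P)%N ->
  [/\ card_bd P = 9%N, equiv_tri3 (coords P) & ehrhart_zeros P = [set - (2 / 3); - (1 / 3)]].
Proof.
move=> lP i1 b8; have [_ sc zP] := polygon_summary lP.
have [b9 e3] : card_bd P = 9%N /\ equiv_tri3 (coords P).
  by case: sc => [i0|b6|[_ ? ?]]; [rewrite i0 in i1|rewrite i1 in b6; lia|].
split=> //; rewrite i1 b9 in zP.
have three : 3 != 0 :> R[i] by rewrite pnatr_eq0.
have fac s : ((2 * 1 + 9)%:R - 2) * s ^+ 2 + 9%:R * s + 2 = (3 * s + 2) * (3 * s + 1) :> R[i].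
  by ring.
apply/seteqP; split=> s.
  move=> /zP; rewrite fac => /eqP; rewrite mulf_eq0 => /orP[|] /eqP E; [left|right];
    by apply: (mulfI three); rewrite /= mulrN mulrCA divff // mulr1;
       apply/eqP; rewrite -addr_eq0 E.
by move=> [|] /= ->; apply/zP; rewrite fac; field.
Qed.

End Zeros.

(** * Cluster points *)

Section ClusterPoints.
Variable R : realType.

(* With w = ceil (n (1 - t2) / (2 t2)) the quadrilateral of parameters n and w has
   (2 w + n) x^2 + (n + 4) x + 2 of opposite signs at - t2 and - t1 once n is large. *)
Lemma zero_between (c d : R) : - (1 / 2) <= c -> c < d -> d <= 0 ->
  exists r, c < r < d /\ Gamma2 R r%:C%C.
Proof.
move=> c0 cd d0.
(* [- t2] and [- t1] cut the interval from [c] to [d] into thirds. *)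
pose t1 := - (d - (d - c) / 3); pose t2 := - (c + (d - c) / 3).
have t10 : 0 < t1 by rewrite /t1; lra.
have t12 : t1 < t2 by rewrite /t1 /t2; lra.
have t2h : t2 < 1 / 2 by rewrite /t2; lra.
have t2c : c < - t2 by rewrite /t2; lra.
have t1d : - t1 < d by rewrite /t1; lra.
clearbody t1 t2.
have t20 : 0 < t2 by lra.
have t1n : t1 != 0 by rewrite gt_eqF.
have t2n : t2 != 0 by rewrite gt_eqF.
(* At [x = - t] the quadratic has the sign of [w - (n f - C)], where [f = (1 - t) / (2 t)] and
   [C = (2 - 4 t) / (2 t ^+ 2)]. *)
pose f2 := (1 - t2) / (2 * t2); pose f1 := (1 - t1) / (2 * t1).
pose C := (2 - 4 * t1) / (2 * t1 ^+ 2).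
have f1E : 2 * t1 ^+ 2 * f1 = t1 * (1 - t1) by rewrite /f1; field.
have f2E : 2 * t2 ^+ 2 * f2 = t2 * (1 - t2) by rewrite /f2; field.
have CE : 2 * t1 ^+ 2 * C = 2 - 4 * t1 by rewrite /C; field.
have f12 : f2 < f1.
  rewrite -subr_gt0 (_ : f1 - f2 = (t2 - t1) / (2 * t1 * t2)).
    by rewrite divr_gt0 ?mulr_gt0 //; lra.
  by rewrite /f1 /f2; field; rewrite t1n t2n.
have f2h : 1 / 2 <= f2 by rewrite /f2 ler_pdivlMr ?mulr_gt0 //; lra.
have C0 : 0 < C by rewrite /C divr_gt0 ?mulr_gt0 ?exprn_gt0 //; lra.
clearbody f1 f2 C.
(* This [n] leaves room for an integer [w] between [n f2] and [n f1 - C]. *)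
pose n := Num.bound ((1 + C) / (f1 - f2)).
have nP : (1 + C) < n%:R * (f1 - f2).
  rewrite -ltr_pdivrMr ?subr_gt0 //; apply: le_lt_trans (archi_boundP _); first exact: lexx.
  by rewrite divr_ge0 ?subr_ge0 ?(ltW f12) //; lra.
clearbody n.
have n0 : 0 < n%:R :> R.
  rewrite -(pmulr_lgt0 _ (x := f1 - f2)) ?subr_gt0 //; lra.
have nf0 : 0 <= n%:R * f2 by rewrite mulr_ge0 ?ltW //; lra.
pose w := `|Num.ceil (n%:R * f2)|%N.
have wE : w%:R = (Num.ceil (n%:R * f2))%:~R :> R.
  rewrite /w -[X in X = _]/((`|Num.ceil (n%:R * f2)|%N%:Z)%:~R) gez0_abs //.
  by rewrite ceil_ge0; lra.
have wl : n%:R * f2 <= w%:R by rewrite wE ceil_ge.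
have wu : w%:R < n%:R * f2 + 1.
  by have := ceilB1_lt (n%:R * f2); rewrite wE intrB; lra.
clearbody w.
have nw : (n <= 2 * w)%N.
  rewrite -(ler_nat R) natrM.
  have : n%:R * (1 / 2) <= n%:R * f2 by rewrite ler_wpM2l.
  by lra.
have w0 : (0 < w)%N.
  by rewrite ltr0n in n0; have := leq_trans n0 nw; rewrite muln_gt0.
have [P [lP iE bE]] := ex_quadrilateral R w0 nw.
(* The sign is reversed since [poly_ivt] asks for a value at most 0 at the left end. *)
pose p : {poly R} := - ((2 * w%:R + n%:R)%:P * 'X^2 + (n%:R + 4)%:P * 'X + 2%:P).
have pE x : p.[x] = - ((2 * w%:R + n%:R) * x ^+ 2 + (n%:R + 4) * x + 2).
  by rewrite /p hornerN !(hornerD, hornerM, hornerC, hornerXn, hornerX).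
have sq1 : 0 < 2 * t1 ^+ 2 by rewrite mulr_gt0 ?exprn_gt0.
have sq2 : 0 < 2 * t2 ^+ 2 by rewrite mulr_gt0 ?exprn_gt0.
have P2 : p.[- t2] <= 0.
  rewrite pE sqrrN oppr_le0.
  have : 2 * t2 ^+ 2 * (n%:R * f2) <= 2 * t2 ^+ 2 * w%:R by rewrite ler_pM2l.
  by rewrite mulrCA f2E; lra.
have P1 : 0 <= p.[- t1].
  rewrite pE sqrrN oppr_ge0.
  have H : 2 * t1 ^+ 2 * w%:R <= 2 * t1 ^+ 2 * (n%:R * f1 - C) by rewrite ler_pM2l //; lra.
  rewrite mulrBr CE [_ * (_ * f1)]mulrCA f1E in H; lra.
have t21 : - t2 <= - t1 by lra.
have [|r /andP[r2 r1] rr] := @poly_ivt _ p _ _ t21; first by rewrite P2 P1.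
exists r; split; first by apply/andP; split; lra.
exists P => //; apply/(ehrhart_zeroP _ lP); rewrite iE bE /quad_zero /= mul0r; split=> //.
have AE : (2 * w.-1 + (n + 4))%:R = 2 * w%:R + n%:R + 2 :> R.
  have -> : w%:R = w.-1%:R + 1 :> R by rewrite natr1 prednK.
  by rewrite natrD natrM natrD; ring.
move/rootP: rr; rewrite pE AE natrD expr0n subr0 => /eqP; rewrite oppr_eq0 => /eqP <-.
ring.
Qed.

(** For each point of [L] in turn, the interval is halved and a half without the point is kept. *)
Lemma finite_avoid (L : seq R) (c d : R) : c < d ->
  exists c' d', [/\ c <= c', c' < d', d' <= d & forall x, x \in L -> ~~ (c' < x < d')].
Proof.
elim: L c d => [|a L IH] c d cd; first by exists c, d; split.
have [c' [d' [H1 H2 H3 H4]]] := IH _ _ cd.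
pose m := (c' + d') / 2; have [am|ma] := lerP a m.
  exists m, d'; split=> //; rewrite ?/m; [lra|lra|].
  move=> x; rewrite inE => /orP[/eqP->|/H4]; first by rewrite ltNge am.
  by apply: contraNN => /andP[mx ->]; rewrite andbT; apply: le_lt_trans mx; rewrite /m; lra.
exists c', m; split=> //; rewrite ?/m; [lra|lra|].
move=> x; rewrite inE => /orP[/eqP->|/H4]; first by rewrite [a < _]ltNge ltW ?andbF.
by apply: contraNN => /andP[-> xm] /=; apply: lt_le_trans xm _; rewrite /m; lra.
Qed.

Lemma normc_lt (z : R[i]) (r : R) : 0 <= r ->
  (`|z| < r%:C%C) = (complex.Re z ^+ 2 + complex.Im z ^+ 2 < r ^+ 2).
Proof.
move=> r0; rewrite normc_def ltcR; have [z0|z0] := leP (r ^+ 2) 0.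
  have -> : r = 0 by apply/eqP; rewrite -sqrf_eq0 eq_le z0 sqr_ge0.
  by rewrite ltNge sqrtr_ge0 expr0n ltNge addr_ge0 ?sqr_ge0.
by rewrite -{1}(ger0_norm r0) -sqrtr_sqr ltr_sqrt.
Qed.

Lemma nbhs_complex (z : R[i]) (e : R) : 0 < e ->
  nbhs (z : R[i]^o) [set s : R[i] |
    (complex.Re (s - z)) ^+ 2 + (complex.Im (s - z)) ^+ 2 < e ^+ 2].
Proof.
move=> e0; apply/nbhs_ballP; exists e%:C%C; first by rewrite /= ltcR.
move=> s; rewrite -ball_normE /= distrC => H.
by rewrite normc_lt ?ltW in H.
Qed.

Lemma finite_quad_zeros (N : nat) :
  finite_set [set s : R[i] | exists i b : nat, [/\ (i < N)%N, (b < N)%N &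
    ((2 * i + b)%:R - 2) * s ^+ 2 + b%:R * s + 2 = 0]].
Proof.
pose p (i b : nat) : {poly R[i]} := ((2 * i + b)%:R - 2)%:P * 'X^2 + b%:R%:P * 'X + 2%:P.
have pE i b s : (p i b).[s] = ((2 * i + b)%:R - 2) * s ^+ 2 + b%:R * s + 2.
  by rewrite /p !(hornerD, hornerM, hornerC, hornerXn, hornerX).
(* The value 2 at 0 rules out the zero polynomial for all [i] and [b]. *)
have p0 i b : p i b != 0.
  apply/eqP => /(congr1 (horner^~ 0)); rewrite pE horner0 expr0n !mulr0 !add0r.
  by move/eqP; rewrite pnatr_eq0.
apply: (@sub_finite_set _ _ (\bigcup_(i in `I_N) \bigcup_(b in `I_N) [set s | root (p i b) s])).
  by move=> s [i [b [iN bN E]]]; exists i => //; exists b => //=; rewrite rootE pE E.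
apply: bigcup_finite => [|i _]; first exact: finite_II.
apply: bigcup_finite => [|b _]; first exact: finite_II.
apply: contrapT => inf; have [X XP] := infinite_set_fset (size (p i b)) inf.
rewrite leqNgt => /negP; apply; apply: max_poly_roots => //; last exact: fset_uniq.
by apply/allP => s /XP.
Qed.

Lemma gamma2_cluster : cluster_points (Gamma2 R) =
  [set s : R[i] | complex.Im s = 0 /\ - (1 / 2) <= complex.Re s <= 0].
Proof.
have zlt0 s : Gamma2 R s -> complex.Re s < 0.
  move=> [P lP /(ehrhart_zeroP _ lP)]; have [b3 _ _] := polygon_summary lP.
  exact: quad_lt0.
apply/seteqP; split=> z /=.
  move=> cz.
  have y0 : complex.Im z = 0.
    (* Zeros near a nonreal [z] have imaginary part larger than [e] in absolute value. Since
       [2 i + b - 2] is 2 over the squared modulus of the zero, only finitely many [i] and [b]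
       occur. *)
    apply/eqP/negPn/negP => y0; pose e := `|complex.Im z| / 2.
    have e0 : 0 < e by rewrite divr_gt0 // normr_gt0.
    apply: (cz _ (nbhs_complex z e0)).
    pose N := Num.bound (2 / e ^+ 2 + 4).
    apply: sub_finite_set (finite_quad_zeros N) => s /= [sz [P lP Zs]].
    have [b3 _ zP] := polygon_summary lP.
    exists (card_int P), (card_bd P); have A1 := @area_gt0 R (card_int P) _ b3.
    have ye : e < `|complex.Im s|.
      have : `|complex.Im (s - z)| < e.
        rewrite -ltr_sqr ?nnegrE ?(ltW e0) // real_normK ?num_real //.
        by apply: le_lt_trans sz; rewrite lerDr sqr_ge0.
      have -> : complex.Im (s - z) = complex.Im s - complex.Im z by case: (s) (z) => ? ? [].
      have := ler_normB (complex.Im s) (complex.Im s - complex.Im z).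
      by rewrite subKr /e; lra.
    have ys0 : complex.Im s != 0 by rewrite -normr_gt0; apply: lt_trans ye.
    have [_ E _] := quad_nonreal b3 ((ehrhart_zeroP s lP).1 Zs) ys0.
    have ee : e ^+ 2 < complex.Re s ^+ 2 + complex.Im s ^+ 2.
      have : e ^+ 2 < complex.Im s ^+ 2.
        by rewrite -[X in _ < X]real_normK ?num_real // ltr_sqr ?nnegrE ?(ltW e0).
      by have := sqr_ge0 (complex.Re s); lra.
    have e20 : 0 < e ^+ 2 by rewrite exprn_gt0.
    have AN : (2 * card_int P + card_bd P)%:R - 2 <= 2 / e ^+ 2 :> R.
      by rewrite ler_pdivlMr // -[X in _ <= X]E ler_wpM2l ?(ltW ee) //; lra.
    have NP : 2 / e ^+ 2 + 4 < N%:R.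
      apply: archi_boundP; rewrite addr_ge0 // divr_ge0 // ltW //.
    have : (2 * card_int P + card_bd P < N)%N.
      by rewrite -(ltr_nat R); lra.
    move=> H; split; last exact/zP.
      by apply: leq_ltn_trans H; apply: leq_trans (leq_addr _ _); apply: leq_pmull.
    by apply: leq_ltn_trans H; apply: leq_addl.
  split=> //; apply/andP; split; rewrite leNgt; apply/negP => xz.
    have e0 : 0 < - (1 / 2) - complex.Re z by lra.
    apply: (cz _ (nbhs_complex z e0)).
    (* A disc to the left of -1/2 meets [Gamma2] in the isolated points at most. *)
    apply: (@sub_finite_set _ _ [set -2; -1; - (2 / 3)]).
      move=> s /= [sz /gamma2_region[//|[/andP[xs _] _]]]; exfalso.
      move: sz; apply/negP; rewrite -leNgt.
      have -> : complex.Re (s - z) = complex.Re s - complex.Re z by case: (s) (z) => ? ? [].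
      apply: (@le_trans _ _ ((complex.Re s - complex.Re z) ^+ 2)); last by rewrite lerDl sqr_ge0.
      by rewrite ler_sqr ?nnegrE; lra.
    by rewrite !finite_setU; split; [split|]; apply: finite_set1.
  apply: (cz _ (nbhs_complex z xz)).
  rewrite (_ : _ `&` _ = set0) //; apply/seteqP; split=> // s /= [sz /zlt0 xs].
  move: sz; apply/negP; rewrite -leNgt.
  have -> : complex.Re (s - z) = complex.Re s - complex.Re z by case: (s) (z) => ? ? [].
  apply: (@le_trans _ _ ((complex.Re s - complex.Re z) ^+ 2)); last by rewrite lerDl sqr_ge0.
  by rewrite -[X in _ <= X]sqrrN opprB ler_sqr ?nnegrE; lra.
case: z => c y /= [-> /andP[c0 c1]] U /nbhs_ballP[e' /= e'0 eU] finU.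
(* Radii of balls in [R[i]] are complex numbers; positive ones are real. *)
have [e e0 eE] : exists2 e : R, 0 < e & e' = e%:C%C.
  case: e' e'0 {eU} => x' y'; rewrite ltcE /= => /andP[/eqP-> x0].
  by exists x'.
(* If [U] held only finitely many zeros, a subinterval near [c] would avoid their real parts, yet
   [zero_between] puts a zero there. *)
pose L := [seq complex.Re s | s <- fset_set (U `&` Gamma2 R)].
have lo : Num.max (- (1 / 2)) (c - e) < Num.min 0 (c + e).
  rewrite gt_max !lt_min; apply/andP; split; apply/andP; split; lra.
have [c' [d' [H1 H2 H3 H4]]] := finite_avoid L lo.
move: H1 H3; rewrite ge_max le_min => /andP[ch ce] /andP[d0 de].
have [r [/andP[cr rd] Gr]] := zero_between ch H2 d0.
have rU : U r%:C%C.
  apply: eU; rewrite -ball_normE /= eE distrC normc_lt ?ltW //=.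
  rewrite subrr expr0n addr0 -real_normK ?num_real // ltr_sqr ?nnegrE ?(ltW e0) //.
  by rewrite ltr_norml; apply/andP; split; lra.
have /H4 : r \in L.
  apply/mapP; exists r%:C%C => //.
  by rewrite in_fset_set // inE.
by rewrite cr rd.
Qed.

End ClusterPoints.

Theorem theorem1p9 (R : realType) :
  (* (i) *)
  (forall P : set 'cV[R]_2, lattice_polygon P ->
     forall s : R[i], ehrhart_zeros P s -> s \isn't Num.real ->
       `|s + 2 / (card_bd P)%:R| = 2 / (card_bd P)%:R) /\
  (* (ii) *)
  (forall P : set 'cV[R]_2, lattice_polygon P ->
     (forall s : R[i], ehrhart_zeros P s -> s \is Num.real) <->
     (card_int P)%:R <= ((card_bd P)%:R / 4 - 1) ^+ 2 :> R) /\
  (* (iii) *)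
  Gamma2 R `<=`
    [set -2; -1; - (2 / 3)] `|`
    [set s : R[i] | - (1 / 2) <= complex.Re s < 0 /\ `|s + 2 / 3| <= 2 / 3] /\
  (* (iv) *)
  cluster_points (Gamma2 R) =
    [set s : R[i] | complex.Im s = 0 /\ - (1 / 2) <= complex.Re s <= 0] /\
  (* (v) *)
  Gamma20 R =
    [set -1] `|` [set s : R[i] | exists2 l : int, 1 <= l & s = - (2 / l%:~R)] /\
  (* (vi) *)
  [set s | Gamma2 R s /\ complex.Re s = - (1 / 2)] =
    [set s | exists P : set 'cV[R]_2,
       [/\ lattice_polygon P, card_int P = 1%N, (card_bd P <= 8)%N
         & ehrhart_zeros P s]] /\
  (exists P : set 'cV[R]_2,
     [/\ lattice_polygon P, card_int P = 1%N & (8 < card_bd P)%N]) /\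
  (forall P Q : set 'cV[R]_2,
     lattice_polygon P -> card_int P = 1%N -> (8 < card_bd P)%N ->
     lattice_polygon Q -> card_int Q = 1%N -> (8 < card_bd Q)%N ->
     unimodularly_equivalent P Q) /\
  (forall P : set 'cV[R]_2,
     lattice_polygon P -> card_int P = 1%N -> (8 < card_bd P)%N ->
     card_bd P = 9%N /\
     ehrhart_zeros P = [set - (2 / 3); - (1 / 3)]).
Proof.
split; first by move=> P lP s; apply: nonreal_circle.
split; first exact: real_zeros_iff.
split; first exact: gamma2_region.
split; first exact: gamma2_cluster.
split; first exact: gamma20_eq.
split; first exact: gamma2_half.
split; first by have [P [lP i1 b9]] := ex_tri3 R; exists P; rewrite b9.
split=> [P Q lP iP bP lQ iQ bQ|P lP iP bP].
  have [_ tP _] := exceptional_zeros lP iP bP.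
  have [_ tQ _] := exceptional_zeros lQ iQ bQ.
  exact: equiv_tri3_unimodular.
by have [? _ ?] := exceptional_zeros lP iP bP.
Qed.
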